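(* Let $n\ge0$ be an integer, let $N_1,\dots,N_n$ be nonnegative integers and $N=\sum_{\iota=1}^nN_\iota$. Let $q,a,b,c,d,e,x_1,\dots,x_n,y_1,\dots,y_n$ be complex numbers with $0<|q|<1$, all parameters nonzero, such that no zero factors occur in denominators. Suppose $\frac{ab}{x_\iota y_\iota}=q^{N_\iota}$ for $1\le\iota\le n$ and $\left|\frac{cde}{abq^{N+1}}\right|<1$. Then $$\rho(a,b;c,d,e,\{x_\iota,y_\iota\}_{\iota=1}^n)-\rho(b,a;c,d,e,\{x_\iota,y_\iota\}_{\iota=1}^n)$$ $$=\left(\frac1b-\frac1a\right)\frac{\left(q,\,\frac{qa}{b},\,\frac{qb}{a},\,c,\,d,\,e,\,\frac{cd}{ab},\,\frac{ce}{ab},\,\frac{de}{ab};q\right)_\infty}{\left(-qa,\,-qb,\,-\frac ca,\,-\frac cb,\,-\frac da,\,-\frac db,\,-\frac ea,\,-\frac eb,\,\frac{cde}{qab};q\right)_\infty}$$ $$\times\;\prod_{\iota=1}^n\frac1{x_\iota}\,\frac{\left(-\frac{qa}{x_\iota},\,-\frac{qb}{x_\iota},\,\frac{qy_\iota}{e},\,\frac{ey_\iota}{ab};q\right)_\infty}{\left(\frac{e}{x_\iota},\,\frac{qab}{ex_\iota},\,-\frac{y_\iota}{a},\,-\frac{y_\iota}{b};q\right)_\infty}$$ $$\times\;\sum_{\tilde m}\frac{\left(\frac{x_ny_n}{ab};q\right)_{m_n}}{(q;q)_{m_n}}\,\frac{\left(\frac qe,\,\frac{qab}{ce},\,\frac{qab}{de};q\right)_{M_n}}{\left(\frac{qx_n}{e},\,\frac{qy_n}{e},\,\frac{q^2ab}{cde};q\right)_{M_n}}\,q^{M_n}$$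 $$\times\;\prod_{s=1}^{n-1}\frac{\left(\frac{x_sy_s}{ab};q\right)_{m_s}}{(q;q)_{m_s}}\,\frac{\left(\frac{qab}{ex_{s+1}},\,\frac{qab}{ey_{s+1}};q\right)_{M_s}}{\left(\frac{qx_s}{e},\,\frac{qy_s}{e};q\right)_{M_s}}\left(\frac{x_{s+1}y_{s+1}}{ab}\right)^{M_s},$$ where $$\rho(a,b;c,d,e,\{x_\iota,y_\iota\}_{\iota=1}^n)=\frac1{b^n}\sum_{k=0}^\infty\left(1-\frac{aq^{2k+1}}{b}\right)\frac{(-\frac1b;q)_{k+1}}{(-qa;q)_k}\,\frac{\left(-\frac{qa}{c},-\frac{qa}{d},-\frac{qa}{e},\left\{-\frac{qa}{x_\iota},-\frac{qa}{y_\iota}\right\}_{\iota=1}^n;q\right)_k}{\left(-\frac cb,-\frac db,-\frac eb,\left\{-\frac{x_\iota}{b},-\frac{y_\iota}{b}\right\}_{\iota=1}^n;q\right)_{k+1}}\left(\frac{cde}{abq^{N+1}}\right)^k,$$ $\rho(b,a;\ldots)$ is obtained by interchanging $a$ and $b$, and the multiple sum runs over $\tilde m=(m_1,\dots,m_n)\in\mathbb N_0^n$ with partial sums $M_s=\sum_{\iota=1}^sm_\iota$ (the factors in the product over $s$ being inside the sum; the sum is finite because $\left(\frac{x_sy_s}{ab};q\right)_{m_s}=(q^{-N_s};q)_{m_s}$). For $n=0$ the product over $\iota$ and the multiple sum are both interpreted as $1$.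
   Context: $\mathbb N_0$ denotes the nonnegative integers. For complex $x$ and integer $n\ge 0$: $(x;q)_n=\prod_{i=0}^{n-1}(1-xq^i)$ with $(x;q)_0=1$; $(x;q)_\infty=\prod_{k\ge0}(1-xq^k)$ for $|q|<1$. Also $(z_1,\dots,z_m;q)_n=(z_1;q)_n\cdots(z_m;q)_n$, for $n$ a nonnegative integer or $\infty$; an entry $\{z_\iota,w_\iota\}_{\iota=1}^n$ in such a list stands for $z_1,w_1,\dots,z_n,w_n$. *)

(* Defs.v *)
From mathcomp Require Import all_boot all_order all_algebra.
From mathcomp Require Export complex.
From mathcomp Require Import all_classical all_reals all_analysis.
Import numFieldNormedType.Exports.

Set Implicit Arguments.
Unset Strict Implicit.
Unset Printing Implicit Defensive.

Import Order.TTheory GRing.Theory Num.Theory.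
Local Open Scope ring_scope.
Local Open Scope classical_set_scope.

(* The definitions are over a numFieldType C, which carries its norm topology;
   they are meant for the field R[i] of complex numbers over R : realType. *)

Definition qpoch (C : numFieldType) (q z : C) (n : nat) : C :=
  \prod_(i < n) (1 - z * q ^+ i).

Definition qpoch_inf (C : numFieldType) (q z : C) : C := limn (qpoch q z).

Definition qpochs (C : numFieldType) (q : C) (zs : seq C) (n : nat) : C :=
  \prod_(z <- zs) qpoch q z n.

Definition qpochs_inf (C : numFieldType) (q : C) (zs : seq C) : C :=
  \prod_(z <- zs) qpoch_inf q z.

Definition factors_neq0 (C : numFieldType) (q z : C) : Prop :=
  forall k : nat, 1 - z * q ^+ k != 0.

(* N is the total of the exponents N_i with a b / (x_i y_i) = q ^ N_i. *)
Definition rho (C : numFieldType) (q a b c d e : C) (n : nat)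
    (x y : n.-tuple C) (N : nat) : C :=
  let zs : seq C := [:: c, d, e & x ++ y] in
  (b ^+ n)^-1 *
  limn (series (fun k : nat =>
    (1 - a * q ^+ (2 * k + 1) / b)
    * (qpoch q (- (1 / b)) k.+1 / qpoch q (- (q * a)) k)
    * (qpochs q [seq - (q * a / z) | z <- zs] k
       / qpochs q [seq - (z / b) | z <- zs] k.+1)
    * (c * d * e / (a * b * q ^+ N.+1)) ^+ k)).

(* Indices are shifted down by one: x`_s is x_(s+1), and
   M s = m_1 + ... + m_s, so that x_s comes with M s.+1 below. *)
Definition multisum_term (C : numFieldType) (q a b c d e : C) (n : nat)
    (x y : n.-tuple C) (m : n.-tuple nat) : C :=
  let M (s : nat) : nat := sumn (take s m) in
  let l := n.-1 in
  qpoch q (x`_l * y`_l / (a * b)) (nth 0%N m l) / qpoch q q (nth 0%N m l)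
  * (qpochs q [:: q / e; q * a * b / (c * e); q * a * b / (d * e)] (M n)
     / qpochs q [:: q * x`_l / e; q * y`_l / e;
                    q ^+ 2 * a * b / (c * d * e)] (M n))
  * q ^+ M n
  * \prod_(s < n.-1)
      (qpoch q (x`_s * y`_s / (a * b)) (nth 0%N m s) / qpoch q q (nth 0%N m s)
       * (qpochs q [:: q * a * b / (e * x`_s.+1);
                       q * a * b / (e * y`_s.+1)] (M s.+1)
          / qpochs q [:: q * x`_s / e; q * y`_s / e] (M s.+1))
       * (x`_s.+1 * y`_s.+1 / (a * b)) ^+ M s.+1).

(* \sum_(_ \in _) is the sum over the (finite) support of the summand: when
   each x_s y_s / (a b) is q ^ - N_s, only the m with m_s <= N_s contribute. *)
Definition multisum (C : numFieldType) (q a b c d e : C) (n : nat)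
    (x y : n.-tuple C) : C :=
  if n == 0%N then 1
  else \sum_(m \in [set: n.-tuple nat]) multisum_term q a b c d e x y m.

(* Main.v *)
Require Import Defs.
From mathcomp Require Import all_boot all_order all_algebra.
From mathcomp Require Import all_classical all_reals all_analysis.
From mathcomp Require Import ring lra zify.
Import numFieldNormedType.Exports.
Import Order.TTheory GRing.Theory Num.Theory.
Local Open Scope ring_scope.
Set Implicit Arguments.
Unset Strict Implicit.

(** Write p = a b, W(z) = (z; q)_oo, and X_k = a q^(k+1) + b q^-k, and put
    Phi_z(k) = W(- z q^(k+1) / b) W(- z q^-k / a).  Replacing k by - k - 1
    exchanges a and b in X_k and in Phi_z(k), so the difference of the two
    series rho is one sum over all integers, written as a difference of two sums
    over the nonnegative integers (a _bisum_ below).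

    Without pairs, the summand of rho is, up to a factor symmetric in a and b,
    the very-well-poised term
      (1 - a q^(2k+1) / b) / b * q^(2k^2+k) (a/b)^(2k)
        * Phi_c(k) Phi_d(k) Phi_e(k) Phi_f(k)    with f = p,
    which has no denominators in c, d, e, f.  Let H(c, d, e, f) be its bisum.
    The series is dominated by a geometric one of ratio |w|, with
    w = c d e f / (p^2 q).

    - A telescoping sum (wp_term_telescope), whose boundary term is symmetric in a
      and b, gives
        (1 - w) H(c,d,e,f) = (1 - ce/p) (1 - de/p) (1 - fe/p) H(c,d,eq,f).
      Iterating, with e q^n -> 0 under the sum, expresses H(c,d,e,f) through
      H(c,d,0,f).  Doing this for the four parameters in turn leaves a constant
      H(0,0,0,0) depending on a and b alone (wp_bisum_product).
    - At c = - q b, e = - q a, d = f = 0 both series stop at k = 0, and this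
      evaluates the constant (wp_bisum_theta).  The outcome is Bailey's sum of a
      bilateral very-well-poised 6-psi-6 series, in a form without poles; the
      constant is the Jacobi triple product.

    A pair (x, y) with x y q^N = p multiplies the summand by a constant times
      prod_(j < N) Q(y q^j),    Q(z) = 1 + z X_k / p + z^2 q / p
    (pair_factorE), a polynomial of degree N in X_k.  A form of the terminating
    q-Saalschuetz sum (pair_expansion) expands it in the products
    prod_(1 <= i <= m) Q(e / q^i), and multiplying by such a product only replaces
    Phi_e by Phi_(e / q^m).  Expanding the pairs one after the other
    (is_bisum_pairs) therefore gives a finite multiple sum of the values
    H(c, d, e / q^M, p), where M is the sum of all m_s; since H is a product, they
    are multiples of H(c, d, e, p) (wp_bisum_lower).  Finally the expansion
    coefficients are rewritten with the quotients of q-shifted factorials of the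
    multiple sum (pair_weightE, multisum_termE). *)

(** * Geometrically dominated series *)

(** The only form of completeness that the argument uses.  Stated over any numFieldType, it
    lets everything below ignore that the field is the field of complex numbers. *)
Definition geom_complete (C : numFieldType) : Prop :=
  forall (f : nat -> C) (K r : C), (forall k, `|f k| <= K * r ^+ k) ->
    0 <= r -> r < 1 -> cvgn (series f).

Section ComplexCompleteness.
Local Open Scope classical_set_scope.
Variable R : realType.
Local Notation C := (R[i] : numFieldType).

Lemma cvg_real_complex (u : nat -> R) (l : R) :
  u @ \oo --> l -> (fun n => real_complex R (u n) : C) @ \oo --> (real_complex R l : C).
Proof.
move=> ul; apply/cvgrPdist_lt => eps eps0.
have epsE : eps = real_complex R (complex.Re eps) by rewrite RRe_real // gtr0_real.
move: eps0; rewrite epsE ltcR => eps0.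
move/cvgrPdist_lt: ul => /(_ _ eps0); apply: filterS => n.
by rewrite -rmorphB normc_def /= expr0n addr0 sqrtr_sqr ltcR.
Qed.

(** The real and the imaginary parts are dominated by the modulus, so both converge absolutely
    in the complete field [R]. *)
Lemma complex_geom_complete : geom_complete C.
Proof.
move=> f K r fK r0 r1.
have K0 : 0 <= K by have := fK 0%N; rewrite expr0 mulr1; apply: le_trans.
pose k0 := complex.Re K; pose s := complex.Re r.
have KE : K = real_complex R k0 by rewrite RRe_real // ger0_real.
have rE : r = real_complex R s by rewrite RRe_real // ger0_real.
move: K0 r0 r1 fK; rewrite KE rE !lecR ltcR => K0 s0 s1 fK.
have cvg_part (h : C -> R) : (forall z, real_complex R `|h z| <= `|z|) ->
    cvgn (series (fun k => h (f k))).
  move=> hle; apply: normed_cvg.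
  apply: (@series_le_cvg _ _ (geometric k0 s)) => [n|n|n|].
  - exact: normr_ge0.
  - by rewrite geometric_ge0.
  - by rewrite -lecR; apply: le_trans (hle _) _; rewrite rmorphM rmorphXn.
  - by apply: is_cvg_geometric_series; rewrite ger0_norm.
have /cvg_ex[u ul] : cvgn (series (fun k => complex.Re (f k))).
  apply: (cvg_part (fun z => complex.Re z)).
  by move=> z; exact: normc_ge_Re.
have /cvg_ex[v vl] : cvgn (series (fun k => complex.Im (f k))).
  apply: (cvg_part (fun z => complex.Im z)).
  move=> z; have := normc_ge_Re (z * - 'i%C); rewrite normrM normrN normCi mulr1.
  by case: z => x y; rewrite /= !(mul0r, mulr0, mulrN1, mulrN, mulr1, oppr0, sub0r, opprK).
apply/cvg_ex; exists (real_complex R u + 'i%C * real_complex R v).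
have -> : series f = (fun n => real_complex R (series (fun k => complex.Re (f k)) n)
   + 'i%C * real_complex R (series (fun k => complex.Im (f k)) n)).
  apply/funext => n; rewrite /series /= !rmorph_sum mulr_sumr -big_split /=.
  by apply: eq_bigr => i _; rewrite [LHS]complexE.
by apply: cvgD; [|apply: cvgMl_tmp]; apply: cvg_real_complex.
Qed.

End ComplexCompleteness.

Section GeometricDomination.
Local Open Scope classical_set_scope.
Context {C : numFieldType}.
Hypothesis cvg_series_geom : geom_complete C.
Implicit Types (f g : nat -> C) (K r : C).

Lemma cvg_expr0 (z : C) : `|z| < 1 -> (fun n => z ^+ n) @ \oo --> (0 : C).
Proof.
move=> z1; apply: cvg_series_cvg_0; apply: (cvg_series_geom (K := 1) (r := `|z|)) => // k.
by rewrite normrX mul1r.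
Qed.

(** The order of [C] is only partial, but norms are comparable with [B], and a strict
    inequality [B < `|l|] is contradicted by a late term. *)
Lemma norm_lim_le (u : nat -> C) l B : u @ \oo --> l -> (forall n, `|u n| <= B) -> `|l| <= B.
Proof.
move=> ul uB; have B0 : 0 <= B by apply: le_trans (uB 0%N).
rewrite real_leNgt ?ger0_real //; apply/negP => Bl.
have e0 : 0 < `|l| - B by rewrite subr_gt0.
move/cvgrPdist_lt: ul => /(_ _ e0) [N _ /(_ N (leqnn N))] /= lu.
suff : `|l| < `|l| by rewrite ltxx.
have : `|l| <= `|l - u N| + `|u N| by rewrite -{1}[l](subrK (u N)) ler_normD.
move=> /le_lt_trans; apply.
by rewrite -[ltRHS](subrK B); apply: ltr_leD.
Qed.

Lemma norm_series_geom f K r n : (forall k, `|f k| <= K * r ^+ k) -> 0 <= r -> r < 1 ->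
  `|series f n| <= K / (1 - r).
Proof.
move=> fK r0 r1.
have K0 : 0 <= K by have := fK 0%N; rewrite expr0 mulr1; apply: le_trans.
have d0 : 0 < 1 - r by rewrite subr_gt0.
apply: le_trans (ler_norm_sum _ _ _) _.
apply: (@le_trans _ _ (\sum_(0 <= k < n) K * r ^+ k)).
  by apply: ler_sum => k _.
rewrite -mulr_sumr ler_wpM2l // big_mkord -[leRHS]div1r ler_pdivlMr // mulrC.
have -> : (1 - r) * \sum_(i < n) r ^+ i = 1 - r ^+ n.
  by rewrite -opprB mulNr -subrX1 opprB.
by rewrite gerBl exprn_ge0.
Qed.

(** Dominated convergence for series, with a geometric majorant: beyond some index the tails
    are uniformly small, and the remaining finite sums converge. *)
Lemma tannery_geom (F : nat -> nat -> C) g K r :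
  (forall n k, `|F n k| <= K * r ^+ k) -> 0 <= r -> r < 1 ->
  (forall k, F ^~ k @ \oo --> g k) ->
  (fun n => limn (series (F n))) @ \oo --> limn (series g).
Proof.
move=> FK r0 r1 Fg.
have gK k : `|g k| <= K * r ^+ k by apply: norm_lim_le (Fg k) _ => n.
have K0 : 0 <= K by have := gK 0%N; rewrite expr0 mulr1; apply: le_trans.
have d0 : 0 < 1 - r by rewrite subr_gt0.
have tail (h : nat -> C) m : (forall k, `|h k| <= K * r ^+ k) ->
    `|limn (series h) - series h m| <= K * r ^+ m / (1 - r).
  move=> hK; have ch : cvgn (series h) by exact: (cvg_series_geom hK r0 r1).
  have cs : (fun n => series h (n + m)%N - series h m) @ \oo --> limn (series h) - series h m.
    by apply: cvgB; [rewrite (cvg_shiftn m (series h))|apply: cvg_cst].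
  apply: norm_lim_le cs _ => n.
  rewrite addnC -[_ - _](_ : series (fun k => h (m + k)%N) n = _); last first.
    rewrite sub_series_geq ?leq_addr // /series /=.
    by rewrite -{2}[m]add0n big_addn addKn; apply: eq_bigr => i _; rewrite addnC.
  apply: norm_series_geom => // k.
  by rewrite -mulrA -exprD.
apply/cvgrPdist_lt => eps eps0.
have e30 : 0 < eps / 3 by rewrite divr_gt0.
have [m mP] : exists m, K * r ^+ m / (1 - r) < eps / 3.
  have : (fun n => K / (1 - r) * r ^+ n) @ \oo --> K / (1 - r) * 0.
    by apply: cvgMl_tmp; apply: cvg_expr0; rewrite ger0_norm.
  rewrite mulr0 => /cvgrPdist_lt /(_ _ e30) [N _ /(_ N (leqnn N))] /=.
  rewrite sub0r normrN ger0_norm => [H|]; first by exists N; rewrite mulrAC.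
  by rewrite !mulr_ge0 ?invr_ge0 ?exprn_ge0 // ltW.
have : (fun n => series (F n) m) @ \oo --> series g m.
  by rewrite /series /=; apply: cvg_big => //; exact: add_continuous.
move=> /cvgrPdist_lt /(_ _ e30); apply: filterS => n Hn.
rewrite (_ : _ - _ = (limn (series g) - series g m) + (series g m - series (F n) m)
   - (limn (series (F n)) - series (F n) m)); last by ring.
apply: le_lt_trans (ler_normB _ _) _.
rewrite (_ : eps = eps / 3 + eps / 3 + eps / 3); last by field.
rewrite ltrD //; last by apply: le_lt_trans (tail _ m _) mP.
apply: le_lt_trans (ler_normD _ _) _.
by rewrite ltrD //; apply: le_lt_trans (tail _ m _) mP.
Qed.

End GeometricDomination.

(** * q-shifted factorials, finite and infinite *)

Section FiniteQPochhammer.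
Context {C : numFieldType}.
Implicit Types (q z : C) (m n k : nat).

Lemma qpoch0 q z : qpoch q z 0 = 1.
Proof. by rewrite /qpoch big_ord0. Qed.

Lemma qpochS q z n : qpoch q z n.+1 = qpoch q z n * (1 - z * q ^+ n).
Proof. by rewrite /qpoch big_ord_recr. Qed.

Lemma qpoch_0 q n : qpoch q 0 n = 1.
Proof. by rewrite /qpoch big1 // => i _; rewrite mul0r subr0. Qed.

Lemma qpochD q z m n : qpoch q z (m + n) = qpoch q z m * qpoch q (z * q ^+ m) n.
Proof.
elim: n => [|n IHn]; first by rewrite addn0 qpoch0 mulr1.
by rewrite addnS !qpochS IHn exprD !mulrA.
Qed.

Lemma qpochSl q z n : qpoch q z n.+1 = (1 - z) * qpoch q (z * q) n.
Proof. by rewrite -add1n qpochD qpochS qpoch0 expr0 mulr1 mul1r expr1. Qed.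

Lemma qpoch_neq0 q z n : factors_neq0 q z -> qpoch q z n != 0.
Proof. by move=> zP; apply/prodf_neq0 => i _; exact: zP. Qed.

Lemma qpoch_neq0_le q z m n : (m <= n)%N -> qpoch q z n != 0 -> qpoch q z m != 0.
Proof. by move=> /subnKC <-; rewrite qpochD mulf_eq0 negb_or => /andP[]. Qed.

End FiniteQPochhammer.

Section InfiniteQPochhammer.
Local Open Scope classical_set_scope.
Context {C : numFieldType}.
Hypothesis Cgc : geom_complete C.
Variable q : C.
Hypothesis q1 : `|q| < 1.
Implicit Types (z : C) (m n k : nat).

Let d0 : 0 < 1 - `|q|. Proof. by rewrite subr_gt0. Qed.

Let half_le : (1 - `|q|) / 2 <= 1 - `|q|.
Proof. by rewrite ler_piMr ?invf_le1 ?ler1n // ltW. Qed.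

(** With [S] the sum of the [`|z| * `|q| ^+ i], the induction keeps the distance to 1 below
    [2 * S]; it closes because [2 * S <= 1].  Boundedness, nonvanishing of the infinite product
    and its continuity at 0 all come from this estimate, applied to a tail. *)
Lemma qpoch_sub1_le z n : 2 * `|z| <= 1 - `|q| ->
  `|qpoch q z n - 1| <= 2 / (1 - `|q|) * `|z|.
Proof.
move=> z_small.
pose S n := `|z| * (1 - `|q| ^+ n) / (1 - `|q|).
have q01 m : 0 <= `|q| ^+ m <= 1 by rewrite exprn_ge0 //= exprn_ile1 // ltW.
have S_small m : 2 * S m <= 1.
  rewrite /S !mulrA ler_pdivrMr // mul1r; apply: le_trans z_small.
  by rewrite ler_piMr ?mulr_ge0 // gerBl; case/andP: (q01 m).
apply: (@le_trans _ _ (2 * S n)); last first.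
  rewrite /S [leRHS]mulrC !mulrA [_ * 2]mulrC ler_pM2r ?invr_gt0 //.
  by rewrite ler_piMr ?mulr_ge0 // gerBl; case/andP: (q01 n).
elim: n => [|n IHn]; first by rewrite qpoch0 subrr normr0 /S subrr mulr0 mul0r mulr0.
have SS : S n.+1 = S n + `|z| * `|q| ^+ n.
  by rewrite /S exprS; field; rewrite gt_eqF.
have t0 : 0 <= `|z| * `|q| ^+ n by rewrite mulr_ge0 ?exprn_ge0.
have -> : qpoch q z n.+1 - 1 =
    qpoch q z n - 1 - (qpoch q z n - 1) * (z * q ^+ n) - z * q ^+ n.
  by rewrite qpochS; ring.
apply: le_trans (ler_normB _ _) _; rewrite SS mulrDr [2 * (_ * _)]mulr_natl mulr2n addrA.
rewrite normrM normrX lerD2r.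
apply: le_trans (ler_normB _ _) _; rewrite lerD // normrM normrM normrX.
by rewrite ler_piMl //; apply: le_trans IHn (S_small n).
Qed.

Lemma qpoch_tail_small Z : 0 <= Z -> exists m, forall z n, `|z| <= Z -> (m <= n)%N ->
  2 * `|z * q ^+ n| <= (1 - `|q|) / 2.
Proof.
move=> Z0.
have : (fun n => 2 * Z * q ^+ n) @ \oo --> 2 * Z * 0.
  by apply: cvgMl_tmp; apply: cvg_expr0.
have e0 : 0 < (1 - `|q|) / 2 by rewrite divr_gt0.
rewrite mulr0 => /cvgrPdist_lt /(_ _ e0) [m _ mP]; exists m => z n zZ mn.
have := mP n mn; rewrite /= sub0r normrN => /ltW; apply: le_trans.
rewrite !normrM !mulrA normr_nat (ger0_norm Z0).
by rewrite ler_wpM2r // ler_wpM2l.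
Qed.

Lemma qpoch_bounded Z : 0 <= Z -> exists2 B, 0 <= B & forall z n, `|z| <= Z -> `|qpoch q z n|
    <= B.
Proof.
move=> Z0; have [m mP] := qpoch_tail_small Z0.
have Z1 : 1 <= 1 + Z by rewrite lerDl.
have head z n : `|z| <= Z -> (n <= m)%N -> `|qpoch q z n| <= (1 + Z) ^+ m.
  move=> zZ nm; apply: (@le_trans _ _ ((1 + Z) ^+ n)); last exact: ler_weXn2l.
  elim: n {nm} => [|n IHn]; first by rewrite qpoch0 normr1.
  rewrite qpochS exprSr normrM ler_pM //.
  apply: le_trans (ler_normB _ _) _; rewrite normr1 lerD2l normrM normrX.
  by apply: le_trans zZ; rewrite ler_piMr // exprn_ile1 // ltW.
exists ((1 + Z) ^+ m * 2) => [|z n zZ].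
  by rewrite mulr_ge0 // exprn_ge0 // addr_ge0.
have [nm|/ltnW mn] := leqP n m.
  apply: le_trans (head z n zZ nm) _.
  by rewrite ler_peMr ?exprn_ge0 ?addr_ge0 // ler1n.
rewrite -(subnKC mn) qpochD normrM ler_pM //; first exact: head.
have small := mP z m zZ (leqnn m).
have near1 : `|qpoch q (z * q ^+ m) (n - m) - 1| <= 1.
  apply: le_trans (qpoch_sub1_le _ (le_trans small half_le)) _.
  by rewrite mulrAC ler_pdivrMr // mul1r; apply: le_trans small half_le.
rewrite -[X in `|X|](subrK 1); apply: le_trans (ler_normD _ _) _.
by rewrite normr1 (_ : 2 = 1 + 1) // lerD2r.
Qed.

Lemma cvg_qpoch z : qpoch q z @ \oo --> qpoch_inf q z.
Proof.
suff cz : cvgn (qpoch q z) by [].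
have [B B0 BP] := qpoch_bounded (normr_ge0 z).
have -> : qpoch q z = (fun n => 1 + series (fun k => - (z * qpoch q z k) * q ^+ k) n).
  apply/funext; elim => [|n IHn]; first by rewrite /series /= big_nil qpoch0 addr0.
  rewrite qpochS /series /= big_nat_recr //= addrA -[X in _ = X + _]IHn.
  by ring.
apply: is_cvgD; first exact: is_cvg_cst.
apply: (Cgc (K := `|z| * B) (r := `|q|)) => // k.
by rewrite normrM normrN normrM normrX ler_wpM2r ?exprn_ge0 // ler_wpM2l // BP.
Qed.

Lemma qpoch_inf_split n z : qpoch_inf q z = qpoch q z n * qpoch_inf q (z * q ^+ n).
Proof.
apply/cvg_lim; first exact: norm_hausdorff.
rewrite -(cvg_shiftn n).
have -> : [sequence qpoch q z (m + n)%N]_m = (fun m => qpoch q z n * qpoch q (z * q ^+ n) m).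
  by apply/funext => m /=; rewrite addnC qpochD.
by apply: cvgMl_tmp; apply: cvg_qpoch.
Qed.

Lemma qpoch_inf_rec z : qpoch_inf q z = (1 - z) * qpoch_inf q (z * q).
Proof. by rewrite (qpoch_inf_split 1) qpochS qpoch0 mul1r expr1 expr0 mulr1. Qed.

Lemma qpoch_inf_0 : qpoch_inf q 0 = 1.
Proof.
apply/cvg_lim; first exact: norm_hausdorff.
have -> : qpoch q 0 = fun=> 1 by apply/funext => n; rewrite qpoch_0.
exact: cvg_cst.
Qed.

Lemma qpoch_inf_bounded Z : 0 <= Z -> exists2 B, 0 <= B & forall z, `|z| <= Z -> `|qpoch_inf q
    z| <= B.
Proof.
move=> Z0; have [B B0 BP] := qpoch_bounded Z0; exists B => // z zZ.
by apply: norm_lim_le (cvg_qpoch (z := z)) _ => n; apply: BP.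
Qed.

Lemma qpoch_inf_sub1_le z : 2 * `|z| <= 1 - `|q| ->
  `|qpoch_inf q z - 1| <= 2 / (1 - `|q|) * `|z|.
Proof.
move=> z_small; have c1 : (fun n => qpoch q z n - 1) @ \oo --> qpoch_inf q z - 1.
  by apply: cvgB; [exact: cvg_qpoch|exact: cvg_cst].
by apply: norm_lim_le c1 _ => n; apply: qpoch_sub1_le.
Qed.

(** A late tail of the product is within 1/2 of 1. *)
Lemma qpoch_inf_neq0 z : factors_neq0 q z -> qpoch_inf q z != 0.
Proof.
move=> zP; have [m mP] := qpoch_tail_small (normr_ge0 z).
have small := mP z m (lexx _) (leqnn m).
rewrite (qpoch_inf_split m) mulf_neq0 ?qpoch_neq0 //.
apply/eqP => t0; have := qpoch_inf_sub1_le (le_trans small half_le).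
rewrite t0 sub0r normrN normr1 mulrAC => le1.
have : 1 <= 2^-1 :> C.
  by apply: le_trans le1 _; rewrite ler_pdivrMr // [leRHS]mulrC.
by rewrite invf_ge1 // (ler_nat _ 2 1).
Qed.

Lemma cvg_qpoch_inf_tail z : (fun n => qpoch_inf q (z * q ^+ n)) @ \oo --> (1 : C).
Proof.
have [m mP] := qpoch_tail_small (normr_ge0 z).
have c0 : (fun n => 2 / (1 - `|q|) * `|z| * `|q| ^+ n) @ \oo --> 2 / (1 - `|q|) * `|z| * 0.
  by apply: cvgMl_tmp; apply: cvg_expr0 => //; rewrite normr_id.
apply/cvgrPdist_lt => eps eps0; move: c0; rewrite mulr0.
move=> /cvgrPdist_lt /(_ _ eps0) [N _ NP].
exists (N + m)%N => // n /= nNm.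
have := NP n (leq_trans (leq_addr _ _) nNm); rewrite /= sub0r normrN.
rewrite ger0_norm; last by rewrite !mulr_ge0 ?invr_ge0 ?exprn_ge0 // ltW.
apply: le_lt_trans; rewrite distrC -mulrA -normrX -normrM.
apply: qpoch_inf_sub1_le; apply: le_trans (mP z n (lexx _) _) _.
  exact: leq_trans (leq_addl _ _) nNm.
exact: half_le.
Qed.

End InfiniteQPochhammer.

(** * Very-well-poised terms and two-sided sums *)

Section BilateralSums.
Local Open Scope classical_set_scope.
Context {C : numFieldType}.
Hypothesis Cgc : geom_complete C.
Variable q : C.
Hypotheses (q0 : q != 0) (q1 : `|q| < 1).
Implicit Types (a b c d e f z : C) (k n : nat).

(** This is [a ^+ k * q ^+ (k * k.+1)./2] times the product of the infinite q-shifted factorials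
    of [- z * q ^+ k.+1 / b] and [- z / (a * q ^+ k)].  The normalisation makes it grow like
    [z ^+ k], and it stays meaningful at [z = 0]. *)
Definition wp_factor a b z k : C :=
  qpoch_inf q (- (z * q ^+ k.+1 / b)) * qpoch_inf q (- (z / a))
  * \prod_(i < k) (z + a * q ^+ i.+1).

(** Equal to [1 + z / p * X + z ^+ 2 * q / p] with [p = a * b] and
    [X = a * q ^+ k.+1 + b / q ^+ k]. *)
Definition wp_quad a b z k : C := (1 + z * q ^+ k.+1 / b) * (1 + z / (a * q ^+ k)).

Definition wp_term a b c d e f k : C :=
  (1 - a * q ^+ (2 * k + 1) / b) / b
  * (wp_factor a b c k * wp_factor a b d k * wp_factor a b e k * wp_factor a b f k)
  / ((a * b) ^+ 2 * q) ^+ k.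

(** A sum over all integers: the terms of negative index, read backwards, are the
    opposites of the [t k]. *)
Definition is_bisum (s t : nat -> C) (l : C) : Prop :=
  [/\ cvgn (series s), cvgn (series t) & l = limn (series s) - limn (series t)].

Lemma is_bisum_ext s t s' t' l :
  (forall k, s k = s' k) -> (forall k, t k = t' k) -> is_bisum s t l -> is_bisum s' t' l.
Proof. by move=> /funext-> /funext->. Qed.

Lemma cvg_seriesZ x (s : nat -> C) l :
  series s @ \oo --> l -> series (fun k => x * s k) @ \oo --> x * l.
Proof.
move=> sl; rewrite (_ : series _ = fun n => x * series s n); first exact: cvgMl_tmp.
by apply/funext => n; rewrite /series /= mulr_sumr.
Qed.

Lemma cvg_series_sum n (s : nat -> nat -> C) (l : nat -> C) :
  (forall i, (i < n)%N -> series (s i) @ \oo --> l i) ->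
  series (fun k => \sum_(i < n) s i k) @ \oo --> \sum_(i < n) l i.
Proof.
move=> sl; rewrite (_ : series _ = fun m => \sum_(i < n) series (s i) m).
  by apply: cvg_big => [|i _]; [exact: add_continuous|exact: sl].
by apply/funext => m; rewrite /series /= exchange_big.
Qed.

Lemma is_bisumZ x s t l :
  is_bisum s t l -> is_bisum (fun k => x * s k) (fun k => x * t k) (x * l).
Proof.
move=> [cs ct ->]; have xs := cvg_seriesZ (x := x) cs; have xt := cvg_seriesZ (x := x) ct.
split; [exact: cvgP xs|exact: cvgP xt|].
by rewrite (cvg_lim _ xs) ?(cvg_lim _ xt) ?mulrBr //; exact: norm_hausdorff.
Qed.

Lemma is_bisum_sum n (s t : nat -> nat -> C) (l : nat -> C) :
  (forall i, (i < n)%N -> is_bisum (s i) (t i) (l i)) ->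
  is_bisum (fun k => \sum_(i < n) s i k) (fun k => \sum_(i < n) t i k) (\sum_(i < n) l i).
Proof.
move=> stl.
have cs : series (fun k => \sum_(i < n) s i k) @ \oo --> \sum_(i < n) limn (series (s i)).
  by apply: (@cvg_series_sum _ _ (fun i => limn (series (s i)))) => i /stl[].
have ct : series (fun k => \sum_(i < n) t i k) @ \oo --> \sum_(i < n) limn (series (t i)).
  by apply: (@cvg_series_sum _ _ (fun i => limn (series (t i)))) => i /stl[].
split; [exact: cvgP cs|exact: cvgP ct|].
rewrite (cvg_lim _ cs) ?(cvg_lim _ ct) -?sumrB; try exact: norm_hausdorff.
by apply: eq_bigr => i _; have [] := stl i (ltn_ord i).
Qed.

(** Each of the two infinite products loses its first factor when [z] becomes [z * q]. *)
Lemma wp_factor_rec a b z k : a != 0 -> b != 0 ->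
  wp_factor a b z k = wp_quad a b z k * wp_factor a b (z * q) k.
Proof.
move=> a0 b0; rewrite /wp_factor /wp_quad.
rewrite (qpoch_inf_rec Cgc q1 (- (z * _ / b))) (qpoch_inf_rec Cgc q1 (- (z / a))).
rewrite !opprK.
have -> : - (z * q ^+ k.+1 / b) * q = - (z * q * q ^+ k.+1 / b) by ring.
have -> : - (z / a) * q = - (z * q / a) by ring.
set A := qpoch_inf q _; set B := qpoch_inf q _.
suff H : (1 + z / a) * \prod_(i < k) (z + a * q ^+ i.+1) =
         (1 + z / (a * q ^+ k)) * \prod_(i < k) (z * q + a * q ^+ i.+1).
  rewrite [LHS](_ : _ = (1 + z * q ^+ k.+1 / b) * A * B *
     ((1 + z / a) * \prod_(i < k) (z + a * q ^+ i.+1))); last by ring.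
  by rewrite H; ring.
have -> : \prod_(i < k) (z * q + a * q ^+ i.+1) = q ^+ k * \prod_(i < k) (z + a * q ^+ i).
  rewrite -[X in q ^+ X]card_ord -prodr_const -big_split.
  by apply: eq_bigr => i _; rewrite exprS /=; ring.
have := erefl (\prod_(i < k.+1) (z + a * q ^+ i)).
rewrite {1}big_ord_recl big_ord_recr expr0 mulr1 /= => H.
have qk : q ^+ k != 0 by rewrite expf_neq0.
apply: (mulfI a0); rewrite !mulrA.
have -> : a * (1 + z / a) = z + a by field.
have -> : a * (1 + z / (a * q ^+ k)) * q ^+ k = z + a * q ^+ k by field; rewrite qk.
by rewrite H mulrC.
Qed.

Lemma wp_factor_succ a b z k : a != 0 -> b != 0 ->
  (1 + z * q ^+ k.+1 / b) * wp_factor a b z k.+1 = (z + a * q ^+ k.+1) * wp_factor a b z k.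
Proof.
move=> a0 b0; rewrite /wp_factor (qpoch_inf_rec Cgc q1 (- (z * q ^+ k.+1 / b))) big_ord_recr /=.
have -> : - (z * q ^+ k.+1 / b) * q = - (z * q ^+ k.+2 / b) by rewrite [q ^+ k.+2]exprSr; ring.
by ring.
Qed.

(** With [r = `|q|], the finite product is at most
    [\prod_(i < k) (zeta + `|a| * r ^+ i.+1)], which is [zeta ^+ k] times a bounded q-shifted
    factorial of base [r]. *)
Lemma wp_factor_bounded a b zeta : a != 0 -> b != 0 -> 0 < zeta ->
  exists2 B, 0 <= B & forall z k, `|z| <= zeta -> `|wp_factor a b z k| <= B * zeta ^+ k.
Proof.
move=> a0 b0 z0.
have [B1 B10 B1P] := qpoch_inf_bounded Cgc q1 (divr_ge0 (ltW z0) (normr_ge0 b)).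
have [B2 B20 B2P] := qpoch_inf_bounded Cgc q1 (divr_ge0 (ltW z0) (normr_ge0 a)).
have nq1 : `| `|q| | < 1 by rewrite normr_id.
have [B3 B30 B3P] := qpoch_bounded Cgc nq1 (normr_ge0 (- (`|a| * `|q| / zeta))).
exists (B1 * B2 * B3) => [|z k zz]; first by rewrite !mulr_ge0.
rewrite /wp_factor !normrM -[leRHS]mulrA ler_pM //.
- rewrite ler_pM //; [apply: B1P|apply: B2P]; rewrite normrN.
    rewrite !normrM normfV normrX ler_pM2r ?invr_gt0 ?normr_gt0 //.
    by apply: le_trans zz; rewrite ler_piMr // exprn_ile1 // ltW.
  by rewrite normrM normfV ler_pM2r ?invr_gt0 ?normr_gt0.
- apply: le_trans (_ : _ <= \prod_(i < k) (zeta + `|a| * `|q| ^+ i.+1)) _.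
    rewrite normr_prod; apply: ler_prod => i _; rewrite normr_ge0 /=.
    by apply: le_trans (ler_normD _ _) _; rewrite normrM normrX lerD2r.
  have -> : \prod_(i < k) (zeta + `|a| * `|q| ^+ i.+1) =
      qpoch `|q| (- (`|a| * `|q| / zeta)) k * zeta ^+ k.
    rewrite /qpoch -[zeta ^+ k](_ : \prod_(i < k) zeta = _); last by rewrite prodr_const card_ord.
    rewrite -big_split /=; apply: eq_bigr => i _; rewrite exprS; field.
    by rewrite gt_eqF.
  rewrite ler_pM2r ?exprn_gt0 //; apply: le_trans (B3P _ k (lexx _)).
  rewrite real_ler_norm // ger0_real // prodr_ge0 // => i _.
  by rewrite mulNr opprK addr_ge0 // !mulr_ge0 ?exprn_ge0 // invr_ge0 ltW.
Qed.

Lemma ler_norm_mul4 (x1 x2 x3 x4 y1 y2 y3 y4 : C) :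
  `|x1| <= y1 -> `|x2| <= y2 -> `|x3| <= y3 -> `|x4| <= y4 ->
  `|x1 * x2 * x3 * x4| <= y1 * y2 * y3 * y4.
Proof. by move=> *; rewrite !normrM !ler_pM ?mulr_ge0. Qed.

Lemma wp_factors_bounded a b z1 z2 z3 z4 : a != 0 -> b != 0 ->
  0 < z1 -> 0 < z2 -> 0 < z3 -> 0 < z4 ->
  exists2 B, 0 <= B & forall c d e f k, `|c| <= z1 -> `|d| <= z2 -> `|e| <= z3 -> `|f| <= z4 ->
    `|wp_factor a b c k * wp_factor a b d k * wp_factor a b e k * wp_factor a b f k|
      <= B * (z1 * z2 * z3 * z4) ^+ k.
Proof.
move=> a0 b0 z10 z20 z30 z40.
have [B1 B10 B1P] := wp_factor_bounded a0 b0 z10.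
have [B2 B20 B2P] := wp_factor_bounded a0 b0 z20.
have [B3 B30 B3P] := wp_factor_bounded a0 b0 z30.
have [B4 B40 B4P] := wp_factor_bounded a0 b0 z40.
exists (B1 * B2 * B3 * B4) => [|c d e f k cz dz ez fz]; first by rewrite !mulr_ge0.
rewrite !exprMn [leRHS](_ : _ = (B1 * z1 ^+ k) * (B2 * z2 ^+ k) * (B3 * z3 ^+ k) * (B4
    * z4 ^+ k)); last by ring.
by apply: ler_norm_mul4; [apply: B1P|apply: B2P|apply: B3P|apply: B4P].
Qed.

(** For nonzero parameters this says [`|c * d * e * f| < `|a * b| ^+ 2 * `|q|].  Asking for
    positive majorants rather than for this inequality keeps the geometric ratio positive when
    a parameter is 0, and lets one majorant serve a whole sequence of parameters. *)
Definition dominated a b c d e f : Prop :=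
  exists z1 z2 z3 z4 : C,
    [/\ [/\ 0 < z1, 0 < z2, 0 < z3 & 0 < z4],
        [/\ `|c| <= z1, `|d| <= z2, `|e| <= z3 & `|f| <= z4]
      & z1 * z2 * z3 * z4 < `|a * b| ^+ 2 * `|q| ].

Lemma wp_term_bounded a b z1 z2 z3 z4 : a != 0 -> b != 0 ->
  0 < z1 -> 0 < z2 -> 0 < z3 -> 0 < z4 ->
  exists K, forall c d e f k, `|c| <= z1 -> `|d| <= z2 -> `|e| <= z3 -> `|f| <= z4 ->
    `|wp_term a b c d e f k| <= K * (z1 * z2 * z3 * z4 / (`|a * b| ^+ 2 * `|q|)) ^+ k.
Proof.
move=> a0 b0 z10 z20 z30 z40.
have [B B0 BP] := wp_factors_bounded a0 b0 z10 z20 z30 z40.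
exists ((1 + `|a / b|) / `|b| * B) => c d e f k cz dz ez fz.
have := BP c d e f k cz dz ez fz; rewrite /wp_term; move: (_ * wp_factor a b f k) => G GB.
have P0 : 0 < `|a * b| ^+ 2 * `|q|.
  by rewrite mulr_gt0 ?exprn_gt0 ?normr_gt0 ?mulf_neq0.
rewrite normrM normfV normrX [`|_ ^+ 2 * q|]normrM normrX expr_div_n mulrA.
rewrite ler_pM2r ?invr_gt0 ?exprn_gt0 // normrM -[leRHS]mulrA ler_pM //.
rewrite normrM normfV ler_pM2r ?invr_gt0 ?normr_gt0 //.
apply: le_trans (ler_normB _ _) _; rewrite normr1 lerD2l mulrAC normrM normrX.
by rewrite ler_piMr // exprn_ile1 // ltW.
Qed.

Lemma dominated_swap a b c d e f : dominated a b c d e f -> dominated b a c d e f.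
Proof. by move=> [z1 [z2 [z3 [z4 H]]]]; exists z1, z2, z3, z4; rewrite [b * a]mulrC. Qed.

Lemma cvg_wp_term a b c d e f : a != 0 -> b != 0 -> dominated a b c d e f ->
  cvgn (series (wp_term a b c d e f)).
Proof.
move=> a0 b0 [z1 [z2 [z3 [z4 [[z10 z20 z30 z40] [cz dz ez fz] lt1]]]]].
have [K KP] := wp_term_bounded a0 b0 z10 z20 z30 z40.
have p0 : 0 < `|a * b| ^+ 2 * `|q| by rewrite mulr_gt0 ?exprn_gt0 ?normr_gt0 ?mulf_neq0.
apply: (Cgc (K := K) (r := z1 * z2 * z3 * z4 / (`|a * b| ^+ 2 * `|q|))).
- by move=> k; apply: KP.
- by rewrite divr_ge0 // ltW // !mulr_gt0.
- by rewrite ltr_pdivrMr // mul1r.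
Qed.

End BilateralSums.

(** * A contiguous relation by telescoping *)

Section BilateralSummation.
Local Open Scope classical_set_scope.
Context {C : numFieldType}.
Hypothesis Cgc : geom_complete C.
Variable q : C.
Hypotheses (q0 : q != 0) (q1 : `|q| < 1).
Variables a b : C.
Hypotheses (a0 : a != 0) (b0 : b != 0).
Implicit Types (c d e f z : C) (k n : nat).
Local Notation p := (a * b).
Local Notation W := (qpoch_inf q).

(** Up to a monomial, the product over [z] in [c, d, e, f] of the infinite q-shifted factorials
    of [- z * q ^+ k / b] and [- z / (a * q ^+ k)].  It is a multiple of the products of the
    very-well-poised factors at [k] and at [k - 1] alike, so that its difference sequence is a
    multiple of the former product: a candidate for a discrete primitive. *)
Definition wp_boundary a b c d e f k : C :=
  (1 + c * q ^+ k / b) * (1 + d * q ^+ k / b) * (1 + e * q ^+ k / b) * (1 + f * q ^+ k / b)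
  * (wp_factor q a b c k * wp_factor q a b d k * wp_factor q a b e k * wp_factor q a b f k)
  / ((a * b) ^+ 2 * q ^+ 2) ^+ k.

(** The difference of two consecutive boundary terms contains a quartic in [u = q ^+ k] which,
    divided by [u ^+ 2], is antisymmetric under [u -> b / (a * q * u)].  Hence it is divisible
    by [1 - a * q * u ^+ 2 / b], and the quotient is [u] times an affine function of
    [X = a * q * u + b / u].  As [wp_quad] is affine in [X] too, the terms with parameters [e]
    and [e * q] are related modulo such a difference. *)
Lemma wp_term_telescope c d e f k :
  (1 - c * d * e * f / (p ^+ 2 * q)) * wp_term q a b c d e f k
  - (1 - c * e / p) * (1 - d * e / p) * (1 - f * e / p) * wp_term q a b c d (e * q) f k
  = e / p * (wp_boundary a b c d (e * q) f k - wp_boundary a b c d (e * q) f k.+1).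
Proof.
have bd_succ : wp_boundary a b c d (e * q) f k.+1 =
    (c + a * q ^+ k.+1) * (d + a * q ^+ k.+1) * (e * q + a * q ^+ k.+1) * (f + a * q ^+ k.+1)
    * (wp_factor q a b c k * wp_factor q a b d k * wp_factor q a b (e * q) k
        * wp_factor q a b f k)
    / (p ^+ 2 * q ^+ 2) ^+ k.+1.
  rewrite /wp_boundary; congr (_ / _).
  have E z := wp_factor_succ Cgc q1 z k a0 b0.
  rewrite [LHS](_ : _ = ((1 + c * q ^+ k.+1 / b) * wp_factor q a b c k.+1)
    * ((1 + d * q ^+ k.+1 / b) * wp_factor q a b d k.+1)
    * ((1 + e * q * q ^+ k.+1 / b) * wp_factor q a b (e * q) k.+1)
    * ((1 + f * q ^+ k.+1 / b) * wp_factor q a b f k.+1)); last by ring.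
  by rewrite !E; ring.
rewrite bd_succ /wp_boundary /wp_term (wp_factor_rec Cgc q0 q1 e k a0 b0) /wp_quad.
have E2 : (p ^+ 2 * q) ^+ k = (p ^+ 2 * q ^+ 2) ^+ k / q ^+ k.
  by rewrite -expr_div_n; congr (_ ^+ _); field.
have E3 : q ^+ (2 * k + 1) = q ^+ k * q ^+ k * q by rewrite addn1 exprSr mul2n -addnn exprD.
rewrite E2 E3 (exprS (_ * q ^+ 2)) (exprS q k).
have u0 : q ^+ k != 0 by rewrite expf_neq0.
have D0 : (p ^+ 2 * q ^+ 2) ^+ k != 0 by rewrite expf_neq0 // mulf_neq0 ?expf_neq0 ?mulf_neq0.
move: (wp_factor q a b c k) (wp_factor q a b d k).
move: (wp_factor q a b (e * q) k) (wp_factor q a b f k).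
move: (q ^+ k) (_ ^+ k) u0 D0 => u D u0 D0 g3 g4 g1 g2.
by field; rewrite a0 b0 q0 u0 D0.
Qed.

Lemma cvg_wp_boundary c d e f : dominated q a b c d e f ->
  wp_boundary a b c d (e * q) f @ \oo --> (0 : C).
Proof.
move=> [z1 [z2 [z3 [z4 [[z10 z20 z30 z40] [cz dz ez fz] lt1]]]]].
have z3q : 0 < z3 * `|q| by rewrite mulr_gt0 ?normr_gt0.
have [B B0 BP] := wp_factors_bounded Cgc q1 a0 b0 z10 z20 z3q z40.
pose r := z1 * z2 * z3 * z4 / (`|p| ^+ 2 * `|q|).
have P0 : 0 < `|p| ^+ 2 * `|q| by rewrite mulr_gt0 ?exprn_gt0 ?normr_gt0 ?mulf_neq0.
have r0 : 0 <= r by rewrite /r divr_ge0 ?mulr_ge0 // ltW.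
have r1 : r < 1 by rewrite /r ltr_pdivrMr // mul1r.
apply: cvg_series_cvg_0; apply: (Cgc (r := r)
  (K := (1 + `|c / b|) * (1 + `|d / b|) * (1 + `|e / b|) * (1 + `|f / b|) * B)) => // k.
have lin z t : `|t| <= 1 -> `|1 + z * t * q ^+ k / b| <= 1 + `|z / b|.
  move=> t1; apply: le_trans (ler_normD _ _) _.
  rewrite normr1 lerD2l (_ : z * t * _ / b = z / b * (t * q ^+ k)); last by ring.
  by rewrite normrM ler_piMr // normrM mulr_ile1 // normrX exprn_ile1 // ltW.
have eqz : `|e * q| <= z3 * `|q| by rewrite normrM ler_wpM2r.
have := BP c d (e * q) f k cz dz eqz fz; rewrite /wp_boundary.
move: (_ * wp_factor q a b f k) => G GB.
rewrite -mulrA normrM -[leRHS]mulrA ler_pM //.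
  by apply: ler_norm_mul4; [have := lin c 1|have := lin d 1|exact: lin (ltW q1)|have := lin f 1];
     rewrite ?normr1 ?mulr1 //; exact.
rewrite normrM normfV normrX /r.
rewrite (_ : z1 * z2 * z3 * z4 / _ = z1 * z2 * (z3 * `|q|) * z4 / `|p ^+ 2 * q ^+ 2|).
  by rewrite expr_div_n [leRHS]mulrA ler_pM2r // invr_gt0 exprn_gt0 // normr_gt0 mulf_neq0
      ?expf_neq0 ?mulf_neq0.
rewrite [`|_ ^+ 2 * _|]normrM !normrX; field.
by rewrite !normr_eq0 q0 mulf_neq0.
Qed.

Lemma dominated_shrink c d e f e' : `|e'| <= `|e| ->
  dominated q a b c d e f -> dominated q a b c d e' f.
Proof.
move=> ee [z1 [z2 [z3 [z4 [Z [cz dz ez fz] lt1]]]]]; exists z1, z2, z3, z4.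
by split => //; split => //; apply: le_trans ez.
Qed.

Lemma lim_wp_term_rec c d e f : dominated q a b c d e f ->
  (1 - c * d * e * f / (p ^+ 2 * q)) * limn (series (wp_term q a b c d e f))
  - (1 - c * e / p) * (1 - d * e / p) * (1 - f * e / p)
    * limn (series (wp_term q a b c d (e * q) f))
  = e / p * wp_boundary a b c d (e * q) f 0.
Proof.
move=> dom; have eqe : `|e * q| <= `|e| by rewrite normrM ler_piMr // ltW.
have ce := cvg_wp_term Cgc q0 q1 a0 b0 dom.
have cq := cvg_wp_term Cgc q0 q1 a0 b0 (dominated_shrink eqe dom).
have partial_sum : (fun n => (1 - c * d * e * f / (p ^+ 2 * q)) * series (wp_term q a b c d e f) n
       - (1 - c * e / p) * (1 - d * e / p) * (1 - f * e / p)
         * series (wp_term q a b c d (e * q) f) n) =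
    (fun n => e / p * (wp_boundary a b c d (e * q) f 0 - wp_boundary a b c d (e * q) f n)).
  apply/funext => n; rewrite /series /= !mulr_sumr -sumrB.
  under eq_bigr => k _ do rewrite wp_term_telescope -opprB mulrN -mulNr.
  by rewrite -mulr_sumr telescope_sumr // mulNr -mulrN opprB.
have lim1 : (fun n => (1 - c * d * e * f / (p ^+ 2 * q)) * series (wp_term q a b c d e f) n
       - (1 - c * e / p) * (1 - d * e / p) * (1 - f * e / p)
         * series (wp_term q a b c d (e * q) f) n) @ \oo -->
    (1 - c * d * e * f / (p ^+ 2 * q)) * limn (series (wp_term q a b c d e f))
    - (1 - c * e / p) * (1 - d * e / p) * (1 - f * e / p)
      * limn (series (wp_term q a b c d (e * q) f)).
  by apply: cvgB; apply: cvgMl_tmp.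
have lim2 : (fun n => e / p * (wp_boundary a b c d (e * q) f 0
    - wp_boundary a b c d (e * q) f n)) @ \oo -->
    e / p * (wp_boundary a b c d (e * q) f 0 - 0).
  by apply: cvgMl_tmp; apply: cvgB; [exact: cvg_cst|exact: cvg_wp_boundary].
move: lim1; rewrite partial_sum => lim1.
by rewrite -[wp_boundary _ _ _ _ _ _ _ in RHS]subr0; apply: cvg_unique lim1 lim2.
Qed.

(** Symmetry in [a] and [b] makes the boundary contributions of the two series cancel. *)
Lemma wp_boundary0 c d e f : wp_boundary a b c d e f 0 =
  W (- (c / a)) * W (- (d / a)) * W (- (e / a)) * W (- (f / a))
  * (W (- (c / b)) * W (- (d / b)) * W (- (e / b)) * W (- (f / b))).
Proof.
have E z : (1 + z * q ^+ 0 / b) * wp_factor q a b z 0 = W (- (z / a)) * W (- (z / b)).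
  rewrite /wp_factor big_ord0 mulr1 (qpoch_inf_rec Cgc q1 (- (z / b))) opprK expr0 expr1.
  by rewrite (_ : - (z / b) * q = - (z * q / b)) ?mulr1; ring.
rewrite /wp_boundary expr0 divr1.
rewrite [LHS](_ : _ = ((1 + c * q ^+ 0 / b) * wp_factor q a b c 0)
    * ((1 + d * q ^+ 0 / b) * wp_factor q a b d 0)
    * ((1 + e * q ^+ 0 / b) * wp_factor q a b e 0)
    * ((1 + f * q ^+ 0 / b) * wp_factor q a b f 0)); last by ring.
by rewrite !E; ring.
Qed.

Lemma cvg_wp_factor0 e k : (fun n => wp_factor q a b (e
    * q ^+ n) k) @ \oo --> wp_factor q a b 0 k.
Proof.
rewrite /wp_factor !mul0r oppr0 qpoch_inf_0; apply: cvgM; first apply: cvgM.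
- have -> : (fun n => W (- (e * q ^+ n * q ^+ k.+1 / b))) =
            (fun n => W (- (e * q ^+ k.+1 / b) * q ^+ n)).
    by apply/funext => n; congr W; ring.
  exact: cvg_qpoch_inf_tail.
- have -> : (fun n => W (- (e * q ^+ n / a))) = (fun n => W (- (e / a) * q ^+ n)).
    by apply/funext => n; congr W; ring.
  exact: cvg_qpoch_inf_tail.
- apply: cvg_big => //; first exact: mul_continuous.
  move=> i _; apply: cvgD; last exact: cvg_cst.
  rewrite -[X in _ --> X](mulr0 e); apply: cvgMl_tmp; exact: cvg_expr0.
Qed.

Lemma cvg_lim_wp_term c d e f : dominated q a b c d e f ->
  (fun n => limn (series (wp_term q a b c d (e * q ^+ n) f))) @ \oo
    --> limn (series (wp_term q a b c d 0 f)).
Proof.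
move=> [z1 [z2 [z3 [z4 [[z10 z20 z30 z40] [cz dz ez fz] lt1]]]]].
have [K KP] := wp_term_bounded Cgc q0 q1 a0 b0 z10 z20 z30 z40.
have P0 : 0 < `|p| ^+ 2 * `|q| by rewrite mulr_gt0 ?exprn_gt0 ?normr_gt0 ?mulf_neq0.
apply: (@tannery_geom _ Cgc _ _ K (z1 * z2 * z3 * z4 / (`|p| ^+ 2 * `|q|))).
- move=> n k; apply: KP => //; rewrite normrM normrX.
  by apply: le_trans ez; rewrite ler_piMr // exprn_ile1 // ltW.
- by rewrite divr_ge0 ?mulr_ge0 // ltW.
- by rewrite ltr_pdivrMr // mul1r.
- move=> k; rewrite /wp_term; do 2?[apply: cvgM; last exact: cvg_cst].
  apply: cvgMl_tmp; apply: cvgM; last exact: cvg_cst.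
  by apply: cvgMl_tmp; apply: cvg_wp_factor0.
Qed.

End BilateralSummation.

(** * Evaluation of the two-sided sum *)

Section BilateralEvaluation.
Local Open Scope classical_set_scope.
Context {C : numFieldType}.
Hypothesis Cgc : geom_complete C.
Variable q : C.
Hypotheses (q0 : q != 0) (q1 : `|q| < 1).
Variables a b : C.
Hypotheses (a0 : a != 0) (b0 : b != 0).
Implicit Types (c d e f z : C) (k n : nat).
Local Notation p := (a * b).
Local Notation W := (qpoch_inf q).

Definition wp_bisum a b c d e f : C :=
  limn (series (wp_term q a b c d e f)) - limn (series (wp_term q b a c d e f)).

Lemma wp_bisum_rec c d e f : dominated q a b c d e f ->
  (1 - c * d * e * f / (p ^+ 2 * q)) * wp_bisum a b c d e f =
  (1 - c * e / p) * (1 - d * e / p) * (1 - f * e / p) * wp_bisum a b c d (e * q) f.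
Proof.
move=> dom; have recab := lim_wp_term_rec Cgc q0 q1 a0 b0 dom.
have recba := lim_wp_term_rec Cgc q0 q1 b0 a0 (dominated_swap dom).
have bdE : wp_boundary q b a c d (e * q) f 0 = wp_boundary q a b c d (e * q) f 0.
  by rewrite !wp_boundary0 // [LHS]mulrC.
rewrite bdE [b * a]mulrC -recab in recba; rewrite /wp_bisum !mulrBr.
apply/eqP; rewrite -subr_eq0; apply/eqP; move: recba.
by move=> /eqP; rewrite -subr_eq0 => /eqP E; rewrite -[RHS]oppr0 -E; ring.
Qed.

Lemma wp_bisum_iter c d e f n : dominated q a b c d e f ->
  qpoch q (c * d * e * f / (p ^+ 2 * q)) n * wp_bisum a b c d e f =
  qpoch q (c * e / p) n * qpoch q (d * e / p) n * qpoch q (f * e / p) n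
  * wp_bisum a b c d (e * q ^+ n) f.
Proof.
move=> dom; elim: n => [|n IHn]; first by rewrite !qpoch0 expr0 !(mul1r, mulr1).
have qn1 : `|q ^+ n| <= 1 by rewrite normrX exprn_ile1 // ltW.
have domn : dominated q a b c d (e * q ^+ n) f.
  by apply: dominated_shrink dom; rewrite normrM ler_piMr.
have := wp_bisum_rec domn; rewrite !mulrA -[e * q ^+ n * q]mulrA -exprSr => recn.
rewrite !qpochS mulrAC IHn [LHS](_ : _ =
   qpoch q (c * e / p) n * qpoch q (d * e / p) n * qpoch q (f * e / p) n *
   ((1 - c * d * e * q ^+ n * f / (p ^+ 2 * q)) * wp_bisum a b c d (e * q ^+ n) f)).
  by rewrite recn; ring.
have -> : c * d * e * q ^+ n * f / (p ^+ 2 * q) = c * d * e * f / (p ^+ 2 * q) * q ^+ n by ring.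
by ring.
Qed.

(** Iterating the contiguous relation sends [e] to 0. *)
Lemma wp_bisum_shift c d e f : dominated q a b c d e f ->
  W (c * d * e * f / (p ^+ 2 * q)) * wp_bisum a b c d e f =
  W (c * e / p) * W (d * e / p) * W (f * e / p) * wp_bisum a b c d 0 f.
Proof.
move=> dom; have domba := dominated_swap dom.
have lhs : (fun n => qpoch q (c * d * e * f / (p ^+ 2 * q)) n * wp_bisum a b c d e f) @ \oo
   --> W (c * d * e * f / (p ^+ 2 * q)) * wp_bisum a b c d e f.
  by apply: cvgM; [exact: cvg_qpoch|exact: cvg_cst].
have rhs : (fun n => qpoch q (c * e / p) n * qpoch q (d * e / p) n * qpoch q (f * e / p) n
  * wp_bisum a b c d (e * q ^+ n) f) @ \oo -->
    W (c * e / p) * W (d * e / p) * W (f * e / p) * wp_bisum a b c d 0 f.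
  apply: cvgM; first by apply: cvgM; first apply: cvgM; exact: cvg_qpoch.
  by apply: cvgB; apply: cvg_lim_wp_term.
have E := funext (fun n => wp_bisum_iter n dom).
by move: lhs; rewrite E => lhs; apply: cvg_unique lhs rhs.
Qed.

Lemma wp_term_swap_de x y c d e f : wp_term q x y c d e f = wp_term q x y c e d f.
Proof. by apply/funext => k; rewrite /wp_term; congr (_ * _ / _); ring. Qed.

Lemma wp_term_swap_cd x y c d e f : wp_term q x y c d e f = wp_term q x y d c e f.
Proof. by apply/funext => k; rewrite /wp_term; congr (_ * _ / _); ring. Qed.

Lemma wp_term_swap_ef x y c d e f : wp_term q x y c d e f = wp_term q x y c d f e.
Proof. by apply/funext => k; rewrite /wp_term; congr (_ * _ / _); ring. Qed.

(** The four parameters play symmetric roles, so each of them can be sent to 0 in turn. *)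
Lemma wp_bisum_product c d e f : dominated q a b c d e f ->
  W (c * d * e * f / (p ^+ 2 * q)) * wp_bisum a b c d e f =
  W (c * d / p) * W (c * e / p) * W (c * f / p) * W (d * e / p) * W (d * f / p) * W (e * f / p)
  * wp_bisum a b 0 0 0 0.
Proof.
move=> dom; rewrite wp_bisum_shift //.
have n0 z : `|0 : C| <= `|z| by rewrite normr0.
have dom1 := dominated_shrink (n0 e) dom.
have E1 : wp_bisum a b c d 0 f = wp_bisum a b c 0 d f.
  by rewrite /wp_bisum !(wp_term_swap_de _ _ c d).
have dom2 : dominated q a b c 0 d f.
  move: dom1 => [z1 [z2 [z3 [z4 [[? ? ? ?] [? ? ? ?] lt1]]]]].
  by exists z1, z3, z2, z4; split; [split|split|rewrite (_ : _ * z4 = z1 * z2 * z3 * z4) //;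
      ring].
have := wp_bisum_shift dom2; rewrite !(mulr0, mul0r) qpoch_inf_0 mul1r mulr1 => E2.
have dom3 := dominated_shrink (n0 d) dom2.
have E3 : wp_bisum a b c 0 0 f = wp_bisum a b 0 0 c f.
  by rewrite /wp_bisum !(wp_term_swap_cd _ _ c 0) !(wp_term_swap_de _ _ 0 c).
have dom4 : dominated q a b 0 0 c f.
  move: dom3 => [z1 [z2 [z3 [z4 [[? ? ? ?] [? ? ? ?] lt1]]]]].
  by exists z2, z3, z1, z4; split; [split|split|rewrite (_ : _ * z4 = z1 * z2 * z3 * z4) //;
      ring].
have := wp_bisum_shift dom4; rewrite !(mulr0, mul0r) qpoch_inf_0 !mul1r => E4.
have dom5 := dominated_shrink (n0 c) dom4.
have E5 : wp_bisum a b 0 0 0 f = wp_bisum a b 0 0 f 0.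
  by rewrite /wp_bisum !(wp_term_swap_ef _ _ 0 0 0 f).
have dom6 : dominated q a b 0 0 f 0.
  move: dom5 => [z1 [z2 [z3 [z4 [[? ? ? ?] [? ? ? ?] lt1]]]]].
  by exists z1, z2, z4, z3; split; [split|split|rewrite (_ : _ * z3 = z1 * z2 * z3 * z4) //;
      ring].
have := wp_bisum_shift dom6; rewrite !(mulr0, mul0r) qpoch_inf_0 !mul1r => E6.
rewrite E1 E2 E3 E4 E5 E6 [f * d]mulrC [f * c]mulrC [f * e]mulrC.
by ring.
Qed.

End BilateralEvaluation.

Section ThetaConstant.
Local Open Scope classical_set_scope.
Context {C : numFieldType}.
Hypothesis Cgc : geom_complete C.
Variable q : C.
Hypotheses (q0 : q != 0) (q1 : `|q| < 1).
Local Notation W := (qpoch_inf q).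

Lemma lim_series_head (u : nat -> C) : (forall k, u k.+1 = 0) -> limn (series u) = u 0.
Proof.
move=> u0; apply/cvg_lim; first exact: norm_hausdorff.
rewrite -(cvg_shiftn 1 (series u)).
have -> : [sequence series u (n + 1)%N]_n = fun=> u 0.
  apply/funext => n; rewrite /series /= addn1 big_nat_recl // big1 ?addr0 //.
exact: cvg_cst.
Qed.

Lemma wp_factor_vanish (a b : C) k : wp_factor q a b (- (q * a)) k.+1 = 0.
Proof. by rewrite /wp_factor big_ord_recl expr1 [a * q]mulrC addNr mul0r mulr0. Qed.

Lemma wp_factor_at0 (a b z : C) : wp_factor q a b z 0 = W (- (z * q / b)) * W (- (z / a)).
Proof. by rewrite /wp_factor big_ord0 mulr1 expr1. Qed.

(** The product formula at [c = - (q * b)], [e = - (q * a)], [d = f = 0], where only the two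
    terms of index 0 survive. *)
Lemma wp_bisum_theta (a b : C) : a != 0 -> b != 0 ->
  wp_bisum q a b 0 0 0 0 = (1 / b - 1 / a) * W q * W (q * a / b) * W (q * b / a).
Proof.
move=> a0 b0.
have half x y : x != 0 -> y != 0 ->
    limn (series (wp_term q x y (- (q * y)) 0 (- (q * x)) 0)) =
    1 / y * (W (q ^+ 2) * W q * W (q * x / y) * W (q * y / x)).
  move=> x0 y0; rewrite lim_series_head => [|k]; last first.
    by rewrite /wp_term wp_factor_vanish mulr0 mul0r mulr0 mul0r.
  rewrite /wp_term !wp_factor_at0 !mul0r !oppr0 !qpoch_inf_0 expr0 divr1 !mulr1.
  rewrite (qpoch_inf_rec Cgc q1 (q * x / y)) muln0 add0n expr1.
  rewrite !mulNr !opprK.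
  rewrite (_ : q * y * q / y = q ^+ 2); last by field.
  rewrite (_ : q * x / x = q); last by field.
  rewrite (_ : q * x * q / y = q * x / y * q); last by ring.
  by rewrite [x * q]mulrC; ring.
have dom : dominated q a b (- (q * b)) 0 (- (q * a)) 0.
  (* The slots of the two zero parameters take any majorants of product [`|a * b|]: the
     other two already contribute [`|q| ^+ 2], one power more than is needed. *)
  exists `|q * b|, `|a * b|, `|q * a|, 1; split.
  - by split; rewrite // normr_gt0 mulf_neq0.
  - by split; rewrite ?normrN // normr0.
  - rewrite !normrM mulr1.
    rewrite [ltLHS](_ : _ = (`|a| * `|b|) ^+ 2 * `|q| * `|q|); last by ring.
    by rewrite gtr_pMr // mulr_gt0 ?exprn_gt0 ?mulr_gt0 ?normr_gt0.
have := wp_bisum_product Cgc q0 q1 a0 b0 dom.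
rewrite !(mulr0, mul0r) qpoch_inf_0 !mulr1 !mul1r.
rewrite (_ : - (q * b) * - (q * a) / (a * b) = q ^+ 2); last by field; rewrite a0 b0.
rewrite {1}/wp_bisum half // (wp_term_swap_de q b a) (wp_term_swap_cd q b a).
rewrite (wp_term_swap_de q b a) half //.
have W2 : W (q ^+ 2) != 0.
  apply: qpoch_inf_neq0 => // k; rewrite -exprD subr_eq0; apply/eqP => E.
  have : `|q ^+ (2 + k)| < 1 by rewrite normrX exprn_ilt1.
  by rewrite -E normr1 ltxx.
by move=> E; apply: (mulfI W2); rewrite -E; ring.
Qed.

End ThetaConstant.

(** * Terminating expansion of a pair factor *)

Lemma mulSnSn n : (n.+1 * n.+1 = n * n + (n + n + 1))%N.
Proof. by lia. Qed.

Section FiniteExpansion.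
Context {C : numFieldType}.
Variable q : C.
Hypotheses (q0 : q != 0) (q1 : `|q| < 1).
Implicit Types (x y z e p X : C) (m M N : nat).

Lemma qpoch_qq_neq0 n : qpoch q q n != 0.
Proof.
apply: qpoch_neq0 => k; rewrite -exprS subr_eq0; apply/eqP => E.
have : `|q ^+ k.+1| < 1 by rewrite normrX exprn_ilt1.
by rewrite -E normr1 ltxx.
Qed.

(** The coefficient of [\prod_(i < m) Q (e / q ^+ i.+1)] in [\prod_(j < N) Q (y * q ^+ j)].
    Written with a q-binomial coefficient and with truncated products, it has no denominator
    that could vanish. *)
Definition pair_coef p y e N m : C :=
  qpoch q q N / (qpoch q q m * qpoch q q (N - m)) * (y / e) ^+ m * q ^+ (m * m)
  * qpoch q (q ^+ m * (q * y / e)) (N - m) * qpoch q (e * y / p) (N - m).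

(** Both rules of Pascal for q-binomial coefficients are used, one for the constant
    coefficient and one for that of [y / e]. *)
Lemma pair_coef_pascal p y e N m : e != 0 -> p != 0 -> (m < N)%N ->
  pair_coef p y e N.+1 m.+1 =
    y * q ^+ N * q ^+ m.+1 / e * pair_coef p y e N m
    + (1 - y * q ^+ N * q ^+ m.+2 / e) * (1 - y * q ^+ N * e / q ^+ m.+1 / p)
      * pair_coef p y e N m.+1.
Proof.
move=> e0 p0 mN; have [r ->] : exists r, N = (m.+1 + r)%N by exists (N - m.+1)%N; rewrite subnKC.
rewrite /pair_coef subSS.
have -> : (m.+1 + r - m = r.+1)%N by rewrite addSnnS addKn.
rewrite addKn (qpochSl q (q ^+ m * (q * y / e))) !qpochS.
have -> : q ^+ m * (q * y / e) * q = q ^+ m.+1 * (q * y / e) by rewrite exprSr; ring.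
have F1 := qpoch_qq_neq0 m; have F2 := qpoch_qq_neq0 r; have F3 := qpoch_qq_neq0 m.+1.
have F4 := qpoch_qq_neq0 r.+1.
move: F3 F4; rewrite !qpochS !mulf_eq0 !negb_or => /andP[_ F3] /andP[_ F4].
rewrite mulSnSn !exprD !exprS ?expr0.
have u0 : q ^+ m != 0 by rewrite expf_neq0.
have v0 : q ^+ r != 0 by rewrite expf_neq0.
move: (qpoch q q m) (qpoch q q r) (qpoch q q (m.+1 + r)) (qpoch q (q * _ * _) r)
  (qpoch q (e * y / p) r) F1 F2 => A B D E F F1 F2.
move: (q ^+ (m * m)) ((y / e) ^+ m) => G H.
move: (q ^+ m) (q ^+ r) u0 v0 F3 F4 => u v u0 v0 F3 F4.
by field; rewrite e0 p0 q0 F1 F2 F3 F4 u0.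
Qed.

Lemma pair_coef0 p y e N : pair_coef p y e N 0 = qpoch q (q * y / e) N * qpoch q (e * y / p) N.
Proof.
by rewrite /pair_coef subn0 qpoch0 muln0 !expr0 !mul1r mulr1 mulfV ?qpoch_qq_neq0 ?mul1r.
Qed.

Lemma pair_coef0S p y e N : e != 0 -> p != 0 ->
  pair_coef p y e N.+1 0 =
  (1 - y * q ^+ N * q ^+ 1 / e) * (1 - y * q ^+ N * e / q ^+ 0 / p) * pair_coef p y e N 0.
Proof. by move=> e0 p0; rewrite !pair_coef0 !qpochS expr0 expr1; field; rewrite e0 p0. Qed.

Lemma pair_coefSS p y e N : e != 0 ->
  pair_coef p y e N.+1 N.+1 = y * q ^+ N * q ^+ N.+1 / e * pair_coef p y e N N.
Proof.
move=> e0; rewrite /pair_coef !subnn !qpoch0 !mulr1 !mulfV ?qpoch_qq_neq0 //.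
by rewrite mulSnSn !exprD !exprS ?expr0; ring.
Qed.

(** All the [Q z] are affine in [X], so [Q (y * q ^+ N)] is a multiple of
    [Q (e / q ^+ m.+1)] plus a constant.  Multiplying the expansion of order [N] by it term by
    term gives the recurrence of the coefficients. *)
Lemma pair_expansion p y e N X : e != 0 -> p != 0 ->
  let Q z := 1 + z / p * X + z ^+ 2 * q / p in
  \prod_(j < N) Q (y * q ^+ j) =
  \sum_(m < N.+1) pair_coef p y e N m * \prod_(i < m) Q (e / q ^+ i.+1).
Proof.
move=> e0 p0 Q; elim: N => [|N IHN].
  by rewrite big_ord1 !big_ord0 pair_coef0 !qpoch0 !mulr1.
have Q_lin m : Q (y * q ^+ N) = y * q ^+ N * q ^+ m.+1 / e * Q (e / q ^+ m.+1)
    + (1 - y * q ^+ N * q ^+ m.+1 / e) * (1 - y * q ^+ N * e / q ^+ m / p).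
  rewrite /Q (exprS q m); have u0 : q ^+ m != 0 by rewrite expf_neq0.
  by field; rewrite p0 e0 q0 u0.
pose chi m := \prod_(i < m) Q (e / q ^+ i.+1).
rewrite big_ord_recr /= IHN mulr_suml.
have step (m : nat) : pair_coef p y e N m * chi m * Q (y * q ^+ N) =
    y * q ^+ N * q ^+ m.+1 / e * pair_coef p y e N m * chi m.+1 +
    (1 - y * q ^+ N * q ^+ m.+1 / e) * (1 - y * q ^+ N * e / q ^+ m / p)
      * pair_coef p y e N m * chi m.
  by rewrite (Q_lin m) /chi big_ord_recr /=; ring.
rewrite (eq_bigr _ (fun (m : 'I_N.+1) _ => step m)).
rewrite big_split /= [X in X + _]big_ord_recr [X in _ + X]big_ord_recl /=.
rewrite [RHS]big_ord_recr [X in _ = X + _]big_ord_recl /=.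
rewrite -/(chi N.+1) -/(chi 0) pair_coef0S // pair_coefSS //.
have -> : \sum_(i < N) pair_coef p y e N.+1 (bump 0 i) * \prod_(i0 < bump 0 i) Q (e / q ^+ i0.+1)
   = \sum_(i < N) y * q ^+ N * q ^+ i.+1 / e * pair_coef p y e N i * chi i.+1 +
     \sum_(i < N) (1 - y * q ^+ N * q ^+ (bump 0 i).+1 / e)
      * (1 - y * q ^+ N * e / q ^+ (bump 0 i) / p) * pair_coef p y e N (bump 0 i) * chi (bump 0 i).
  rewrite -big_split; apply: eq_bigr => i _ /=.
  by rewrite /bump /= add1n -/(chi _) pair_coef_pascal //; ring.
by ring.
Qed.

(** Lowering the argument by [q ^+ M] shifts a window of [N] exponents by [M], so the two
    factorials of length [N] differ by [M] factors at either end. *)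
Lemma qpoch_lower_exchange p e y N M : p != 0 -> e != 0 -> y != 0 ->
  qpoch q (e / q ^+ M * y / p) N * qpoch q (q * p / (e * y * q ^+ N)) M * q ^+ (N * M) =
  qpoch q (e * y / p) N * qpoch q (q * p / (e * y)) M.
Proof.
move=> p0 e0 y0; elim: M => [|M IHM].
  by rewrite !qpoch0 expr0 divr1 muln0 expr0 !mulr1.
have qM0 : q ^+ M != 0 by rewrite expf_neq0.
have qN0 : q ^+ N != 0 by rewrite expf_neq0.
have E : (1 - e / q ^+ M.+1 * y / p) * qpoch q (e / q ^+ M * y / p) N =
         qpoch q (e / q ^+ M.+1 * y / p) N * (1 - e / q ^+ M.+1 * y / p * q ^+ N).
  rewrite -qpochS qpochSl; congr (_ * qpoch q _ N).
  by rewrite exprS; field; rewrite p0 q0 qM0.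
rewrite !qpochS mulnS exprD [RHS]mulrA -IHM.
have L1 : (1 - q * p / (e * y * q ^+ N) * q ^+ M) * q ^+ N =
    - (q * p * q ^+ M / (e * y)) * (1 - e / q ^+ M.+1 * y / p * q ^+ N).
  by rewrite exprS; field; rewrite p0 q0 e0 y0 qM0 qN0.
have L2 : 1 - q * p / (e * y) * q ^+ M =
    - (q * p * q ^+ M / (e * y)) * (1 - e / q ^+ M.+1 * y / p).
  by rewrite exprS; field; rewrite p0 q0 e0 y0 qM0.
rewrite L2 [LHS](_ : _ = qpoch q (e / q ^+ M.+1 * y / p) N
    * qpoch q (q * p / (e * y * q ^+ N)) M * q ^+ (N * M)
    * ((1 - q * p / (e * y * q ^+ N) * q ^+ M) * q ^+ N)); last by ring.
rewrite L1 [LHS](_ : _ = qpoch q (q * p / (e * y * q ^+ N)) M * q ^+ (N * M)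
    * - (q * p * q ^+ M / (e * y))
    * (qpoch q (e / q ^+ M.+1 * y / p) N * (1 - e / q ^+ M.+1 * y / p * q ^+ N))); last by ring.
by rewrite -E; ring.
Qed.

(** The coefficients relative to [e / q ^+ M], up to the value [pair_coef p y e N 0], are the
    terms of a terminating hypergeometric series in [m] times the last factor.  That factor
    telescopes when the shifts [M] of successive pairs are chained.  By induction on [m], from
    the ratio of consecutive coefficients. *)
Lemma pair_coef_shift p x y e N M m : p != 0 -> e != 0 -> x != 0 -> y != 0 ->
  x * y * q ^+ N = p -> (m <= N)%N ->
  qpoch q (q * x / e) (M + m) != 0 -> qpoch q (q * y / e) (M + m) != 0 ->
  pair_coef p y (e / q ^+ M) N m =
  qpoch q (q * y / e) N * qpoch q (e * y / p) N
  * (qpoch q (x * y / p) m / qpoch q q m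
     * (qpoch q (q * p / (e * x)) M * qpoch q (q * p / (e * y)) M
        / (qpoch q (q * x / e) (M + m) * qpoch q (q * y / e) (M + m)))
     * (x * y / p) ^+ M * q ^+ m)
  * ((p / e ^+ 2) ^+ m * q ^+ ((M + m) * (M + m)) / q ^+ (M * M)).
Proof.
move=> p0 e0 x0 y0 pE; have qn0 n : q ^+ n != 0 by rewrite expf_neq0.
elim: m => [|m IHm] mN.
  rewrite addn0 => Fx Fy; rewrite pair_coef0 !qpoch0 !expr0 !(divr1, mul1r, mulr1) mulfV // mulr1.
  have -> : q * y / (e / q ^+ M) = q * y / e * q ^+ M by field; rewrite e0 qn0.
  have E := qpoch_lower_exchange N M p0 e0 y0.
  have E2 : qpoch q (q * y / e) N * qpoch q (q * p / (e * x)) M =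
            qpoch q (q * y / e) M * qpoch q (q * y / e * q ^+ M) N.
    rewrite -qpochD addnC qpochD; congr (_ * qpoch q _ M).
    by rewrite -pE; field; rewrite e0 x0.
  have E3 : q * p / (e * y * q ^+ N) = q * x / e by rewrite -pE; field; rewrite e0 y0 qn0.
  have E4 : (x * y / p) ^+ M * q ^+ (N * M) = 1.
    by rewrite exprM -exprMn -pE (_ : x * y / _ * _ = 1) ?expr1n //; field; rewrite x0 y0 qn0.
  rewrite E3 in E; apply: (mulIf Fx); apply: (mulIf Fy).
  have E5 : qpoch q (e / q ^+ M * y / p) N * qpoch q (q * x / e) M =
      qpoch q (e * y / p) N * qpoch q (q * p / (e * y)) M * (x * y / p) ^+ M.
    by rewrite -E -[LHS]mulr1 -E4; ring.
  transitivity (qpoch q (q * y / e) M * qpoch q (q * y / e * q ^+ M) N *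
     (qpoch q (e / q ^+ M * y / p) N * qpoch q (q * x / e) M)); first by ring.
  by rewrite -E2 E5; field; rewrite Fx Fy.
rewrite !addnS => Fx Fy.
have Fx1 := qpoch_neq0_le (leqnSn _) Fx; have Fy1 := qpoch_neq0_le (leqnSn _) Fy.
have {IHm} IH := IHm (ltnW mN) Fx1 Fy1.
move: Fx Fy; rewrite !qpochS !mulf_eq0 !negb_or => /andP[_ Fx2] /andP[_ Fy2].
have [r NE] : exists r, N = (m.+1 + r)%N by exists (N - m.+1)%N; rewrite subnKC.
have Fm := qpoch_qq_neq0 m; have := qpoch_qq_neq0 m.+1.
rewrite qpochS mulf_eq0 negb_or => /andP[_ Fm1].
have Fr := qpoch_qq_neq0 r; have := qpoch_qq_neq0 r.+1.
rewrite qpochS mulf_eq0 negb_or => /andP[_ Fr1].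
have rec : pair_coef p y (e / q ^+ M) N m.+1 * (1 - q * y / e * q ^+ (M + m))
      * (1 - q * x / e * q ^+ (M + m)) * (1 - q * q ^+ m) =
    pair_coef p y (e / q ^+ M) N m * (1 - x * y / p * q ^+ m) * q
      * (p / e ^+ 2 * q ^+ (M + m + (M + m) + 1)).
  rewrite /pair_coef NE addKn addSnnS addKn.
  rewrite (qpochSl q (q ^+ m * _)) !qpochS.
  have -> : q ^+ m * (q * y / (e / q ^+ M)) * q = q ^+ m.+1 * (q * y / (e / q ^+ M)).
    by rewrite exprSr; ring.
  rewrite mulSnSn.
  move: (qpoch q (q ^+ m.+1 * _) r) (qpoch q (_ * y / p) r) (qpoch q q (m + r.+1)).
  rewrite -pE NE !exprD !exprS !expr0.
  move: (qpoch q q m) (qpoch q q r) Fm Fr => A B A0 B0 D E F.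
  rewrite expr_div_n; move: (q ^+ (m * m)) (y ^+ m) (((e / q ^+ M) ^+ m)^-1) => G H I.
  move: (q ^+ m) (q ^+ M) (q ^+ r) (qn0 m) (qn0 M) (qn0 r) Fm1 Fr1 => u v w u0 v0 w0 Fm1 Fr1.
  by field; rewrite x0 y0 e0 q0 u0 v0 w0 A0 B0 Fm1 Fr1.
have F : (1 - q * y / e * q ^+ (M + m)) * (1 - q * x / e * q ^+ (M + m)) * (1 - q * q ^+ m) != 0.
  by apply: mulf_neq0 => //; apply: mulf_neq0.
apply: (mulIf F); rewrite !mulrA rec IH (exprS _ m) [_ ^+ m.+1 in RHS]exprS.
rewrite mulSnSn [q ^+ (_ + (M + m + (M + m) + 1))]exprD.
move: Fx1 Fy1 (qn0 (M * M)%N) Fx2 Fy2 Fm Fm1.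
move: (qpoch q _ (M + m)) (qpoch q _ (M + m)) (q ^+ (M * M)) (q ^+ (M + m))
    => A B D E A0 B0 D0 Fx2 Fy2 Fm Fm1.
have Fx3 : e - q * x * E != 0.
  by rewrite (_ : _ - _ = e * (1 - q * x / e * E)) ?mulf_neq0 //; field.
have Fy3 : e - q * y * E != 0.
  by rewrite (_ : _ - _ = e * (1 - q * y / e * E)) ?mulf_neq0 //; field.
by field; rewrite e0 p0 A0 B0 D0 Fm Fm1 Fx3 Fy3.
Qed.

End FiniteExpansion.

(** * Summation over all pairs *)

Definition boxes (Ns : seq nat) : seq (seq nat) :=
  foldr (fun N l => [seq m :: ms | m <- iota 0 N.+1, ms <- l]) [:: [::]] Ns.

Section BilateralPairs.
Local Open Scope classical_set_scope.
Context {C : numFieldType}.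
Hypothesis Cgc : geom_complete C.
Variable q : C.
Hypotheses (q0 : q != 0) (q1 : `|q| < 1).
Implicit Types (a b c d e f y z : C) (k m n M N : nat).

Lemma big_boxes_cons N Ns (F : seq nat -> C) :
  \sum_(ms <- boxes (N :: Ns)) F ms =
  \sum_(m < N.+1) \sum_(ms <- boxes Ns) F ((m : nat) :: ms).
Proof.
have -> : boxes (N :: Ns) = [seq m :: ms | m <- index_iota 0 N.+1, ms <- boxes Ns] by [].
by rewrite big_allpairs_dep big_mkord.
Qed.

(** Multiplying by quadratics at [e / q], ..., [e / q ^+ m] only moves the parameter [e], so
    the expanded summand is again very-well-poised. *)
Lemma wp_term_lower a b c d e f m k : a != 0 -> b != 0 ->
  wp_term q a b c d (e / q ^+ m) f k =
  wp_term q a b c d e f k * \prod_(i < m) wp_quad q a b (e / q ^+ i.+1) k.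
Proof.
move=> a0 b0.
suff H : wp_factor q a b (e / q ^+ m) k =
    wp_factor q a b e k * \prod_(i < m) wp_quad q a b (e / q ^+ i.+1) k.
  by rewrite /wp_term H; ring.
elim: m => [|m IHm]; first by rewrite expr0 divr1 big_ord0 mulr1.
rewrite (wp_factor_rec Cgc) // (_ : e / q ^+ m.+1 * q = e / q ^+ m).
  by rewrite IHm big_ord_recr /=; ring.
by rewrite exprS; field; rewrite q0 expf_neq0.
Qed.

Lemma wp_quad_expansion a b y e N k : a != 0 -> b != 0 -> e != 0 ->
  \prod_(j < N) wp_quad q a b (y * q ^+ j) k =
  \sum_(m < N.+1) pair_coef q (a * b) y e N m * \prod_(i < m) wp_quad q a b (e / q ^+ i.+1) k.
Proof.
move=> a0 b0 e0; have p0 : a * b != 0 by rewrite mulf_neq0.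
have quadE z : wp_quad q a b z k =
    1 + z / (a * b) * (a * q ^+ k.+1 + b / q ^+ k) + z ^+ 2 * q / (a * b).
  by rewrite /wp_quad exprS; field; rewrite a0 b0 expf_neq0.
under eq_bigr => j _ do rewrite quadE.
rewrite (pair_expansion q0 q1 _ _ _ e0 p0); apply: eq_bigr => m _; congr (_ * _).
by apply: eq_bigr => i _; rewrite quadE.
Qed.

Lemma wp_bisumP a b c d e f : a != 0 -> b != 0 -> dominated q a b c d e f ->
  is_bisum (wp_term q a b c d e f) (wp_term q b a c d e f) (wp_bisum q a b c d e f).
Proof.
move=> a0 b0 dom; by split=> //; apply: (cvg_wp_term Cgc) => //; apply: dominated_swap.
Qed.

Definition pair_prod a b (ys : seq C) (Ns : seq nat) k : C :=
  \prod_(s < size Ns) \prod_(j < nth 0%N Ns s) wp_quad q a b (ys`_s * q ^+ j) k.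

(** The pair number [s] is expanded relative to [e / q ^+ M], where [M] is the sum of the
    indices chosen for the preceding pairs. *)
Definition pair_weight p e (ys : seq C) (Ns ms : seq nat) : C :=
  \prod_(s < size Ns)
    pair_coef q p ys`_s (e / q ^+ sumn (take s ms)) (nth 0%N Ns s) (nth 0%N ms s).

(** By induction on the list of pairs, with [e] general.  The hypothesis concerns the largest
    parameter [e / q ^+ m] that occurs, for which the series converge most slowly. *)
Lemma is_bisum_pairs a b c d f (ys : seq C) Ns e : a != 0 -> b != 0 -> e != 0 ->
  size ys = size Ns -> dominated q a b c d (e / q ^+ sumn Ns) f ->
  is_bisum (fun k => wp_term q a b c d e f k * pair_prod a b ys Ns k)
           (fun k => wp_term q b a c d e f k * pair_prod b a ys Ns k)
    (\sum_(ms <- boxes Ns)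
       pair_weight (a * b) e ys Ns ms * wp_bisum q a b c d (e / q ^+ sumn ms) f).
Proof.
move=> a0 b0; elim: Ns ys e => [|N Ns IHN] [|y ys] e e0 //=.
  move=> _; rewrite expr0 divr1 => dom; rewrite big_seq1 /pair_weight big_ord0 mul1r /=
    expr0 divr1.
  apply: is_bisum_ext (wp_bisumP a0 b0 dom) => k; by rewrite /pair_prod big_ord0 mulr1.
move=> [sz] dom; rewrite big_boxes_cons.
have qn0 n : q ^+ n != 0 by rewrite expf_neq0.
pose s x z m k := pair_coef q (a * b) y e N m * (wp_term q x z c d (e / q ^+ m) f k
    * pair_prod x z ys Ns k).
pose l m := pair_coef q (a * b) y e N m * \sum_(ms <- boxes Ns)
       pair_weight (a * b) (e / q ^+ m) ys Ns ms
           * wp_bisum q a b c d (e / q ^+ m / q ^+ sumn ms) f.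
have stepE x z : x != 0 -> z != 0 -> x * z = a * b -> forall k,
    \sum_(m < N.+1) s x z m k =
    wp_term q x z c d e f k * pair_prod x z (y :: ys) (N :: Ns) k.
  move=> x0 z0 xz k; rewrite /pair_prod [in RHS]big_ord_recl /=.
  rewrite (wp_quad_expansion _ _ _ x0 z0 e0) xz mulr_suml mulr_sumr; apply: eq_bigr => m _.
  by rewrite /s wp_term_lower // /pair_prod; ring.
have -> : \sum_(m < N.+1) \sum_(ms <- boxes Ns)
     pair_weight (a * b) e (y :: ys) (N :: Ns) ((m : nat) :: ms)
       * wp_bisum q a b c d (e / q ^+ sumn ((m : nat) :: ms)) f = \sum_(m < N.+1) l m.
  apply: eq_bigr => m _; rewrite /l mulr_sumr; apply: eq_bigr => ms _.
  rewrite /pair_weight /= big_ord_recl /= expr0 divr1 -[LHS]mulrA; congr (_ * (_ * _)).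
    apply: eq_bigr => i _; rewrite add0n exprD; congr pair_coef.
    by rewrite invfM mulrA.
  by rewrite exprD invfM !mulrA.
apply: is_bisum_ext (stepE a b a0 b0 erefl) (stepE b a b0 a0 (mulrC _ _)) _.
apply: is_bisum_sum => m mN; apply: is_bisumZ; apply: IHN => //.
  by rewrite mulf_neq0 ?invr_eq0.
apply: dominated_shrink dom; rewrite !normrM !normfV !normrX -mulrA ler_wpM2l //.
rewrite -invfM -exprD lef_pV2 ?posrE ?exprn_gt0 ?normr_gt0 //.
apply: ler_wiXn2l; rewrite // ?ltW //.
by rewrite leq_add2r.
Qed.

End BilateralPairs.

(** * Multi-indices in a box *)

Lemma mem_boxes Ns ms : (ms \in boxes Ns) =
  (size ms == size Ns) && [forall s : 'I_(size Ns), nth 0%N ms s <= nth 0%N Ns s]%N.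
Proof.
elim: Ns ms => [|N Ns IHN] ms.
  rewrite /boxes /= inE; case: ms => //=; symmetry; apply/forallP; case => //.
have -> : boxes (N :: Ns) = [seq m :: ms | m <- iota 0 N.+1, ms <- boxes Ns] by [].
apply/allpairsP/andP => [[[m ms'] [mN msN ->]]|[]].
  move: msN; rewrite IHN => /andP[/eqP sz /forallP H]; split; first by rewrite /= sz.
  apply/forallP; case; case => [|s] sP /=; first by move: mN; rewrite mem_iota add0n ltnS.
  exact: (H (Ordinal (sP : s < size Ns)%N)).
case: ms => // m ms; rewrite [size _]/= eqSS => sz /forallP H.
have mN : m \in iota 0 N.+1 by rewrite mem_iota add0n ltnS; exact: (H ord0).
exists (m, ms); split=> //; rewrite IHN sz; apply/forallP => s; exact: (H (lift ord0 s)).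
Qed.

Lemma boxes_uniq Ns : uniq (boxes Ns).
Proof.
elim: Ns => [|N Ns IHN] //.
have -> : boxes (N :: Ns) = [seq m :: ms | m <- iota 0 N.+1, ms <- boxes Ns] by [].
by apply: allpairs_uniq => //; [exact: iota_uniq|move=> [? ?] [? ?] _ _ /= [-> ->]].
Qed.

Lemma sumn_takeS (ms : seq nat) s : (sumn (take s.+1 ms) = sumn (take s ms) + nth 0 ms s)%N.
Proof.
elim: ms s => [|m ms IHm] [|s] //=; first by rewrite take0 addn0.
by rewrite IHm addnA.
Qed.

Lemma sumn_take_le (ms Ns : seq nat) s : ms \in boxes Ns ->
  (sumn (take s ms) <= sumn (take s Ns))%N.
Proof.
rewrite mem_boxes => /andP[/eqP sz /forallP H]; elim: s => [|s IHs]; first by rewrite !take0.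
rewrite !sumn_takeS leq_add //; case: (ltnP s (size Ns)) => sN; last by rewrite nth_default ?sz.
exact: (H (Ordinal sN)).
Qed.

Section SumOverBoxes.
Context {C : numFieldType}.

(** Turns the sum over the finite support into a sum over an explicit list. *)
Lemma fsbig_boxes n (Ns : n.-tuple nat) (F : n.-tuple nat -> C) (G : seq nat -> C) :
  (forall m : n.-tuple nat, tval m \notin boxes Ns -> F m = 0) ->
  (forall m : n.-tuple nat, tval m \in boxes Ns -> F m = G m) ->
  \sum_(m \in [set: n.-tuple nat]) F m = \sum_(ms <- boxes Ns) G ms.
Proof.
move=> F0 FG.
pose T : seq (n.-tuple nat) := pmap insub (boxes Ns).
have TE : map val T = boxes Ns.
  rewrite /T pmap_filter; last exact: insubK.
  apply/all_filterP/allP => ms; rewrite mem_boxes => /andP[/eqP sz _].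
  by rewrite /= isSome_insub sz size_tuple.
have TU : uniq T by apply: (map_uniq (f := val)); rewrite TE boxes_uniq.
rewrite -TE big_map -(fsbig_widen [set` T]%classic [set: n.-tuple nat]%classic) //.
  rewrite -fsbig_seq // big_seq [RHS]big_seq; apply: eq_bigr => m mT.
  by apply: FG; rewrite -TE map_f.
move=> m [_ /= mT]; apply: F0; apply/negP => mB; apply: mT.
by rewrite -(mem_map val_inj) TE.
Qed.

End SumOverBoxes.

(** * Lowering a parameter of the two-sided sum *)

Section ClosedForm.
Context {C : numFieldType}.
Variable q : C.
Hypotheses (q0 : q != 0) (q1 : `|q| < 1).
Implicit Types (c d e p z w : C) (xs ys : seq C) (ms Ns : seq nat) (m n M : nat).

Lemma qpoch_reverse z M : z != 0 ->
  qpoch q (z / q ^+ M) M * \prod_(i < M) q ^+ i.+1 = qpoch q (q / z) M * (- z) ^+ M.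
Proof.
move=> z0; elim: M => [|M IHM]; first by rewrite !qpoch0 big_ord0 expr0.
have u0 : q ^+ M != 0 by rewrite expf_neq0.
rewrite qpochSl big_ord_recr /= (_ : z / q ^+ M.+1 * q = z / q ^+ M); last first.
  by rewrite exprS; field; rewrite q0 u0.
rewrite [LHS](_ : _ = qpoch q (z / q ^+ M) M * (\prod_(i < M) q ^+ i.+1)
   * ((1 - z / q ^+ M.+1) * q ^+ M.+1)); last by ring.
rewrite IHM qpochS (exprS (- z)) (exprS q M).
by field; rewrite z0 q0 u0.
Qed.

Lemma prod_powers_sqr M : (\prod_(i < M) q ^+ i.+1) ^+ 2 = q ^+ M * q ^+ (M * M).
Proof.
elim: M => [|M IHM]; first by rewrite big_ord0 expr1n muln0 expr0 mulr1.
rewrite big_ord_recr /= exprMn IHM mulSnSn !exprD (exprS q M).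
by ring.
Qed.

(** Each factor is reversed by [qpoch_reverse]; three on the left and one on the right leave
    the square of [\prod_(i < M) q ^+ i.+1], which has no half-integral exponents. *)
Lemma qpoch_lower_ratio p e z1 z2 z3 w M : p != 0 -> e != 0 ->
  z1 != 0 -> z2 != 0 -> z3 != 0 -> w != 0 -> z1 * z2 * z3 * p = w * q * e ^+ 2 ->
  qpoch q (z1 / q ^+ M) M * qpoch q (z2 / q ^+ M) M * qpoch q (z3 / q ^+ M) M
    * qpoch q (q / w) M * ((p / e ^+ 2) ^+ M * q ^+ (M * M))
  = qpoch q (q / z1) M * qpoch q (q / z2) M * qpoch q (q / z3) M * qpoch q (w / q ^+ M) M.
Proof.
move=> p0 e0 z10 z20 z30 w0 zw.
have t0 : \prod_(i < M) q ^+ i.+1 != 0 by apply/prodf_neq0 => i _; rewrite expf_neq0.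
have R1 := qpoch_reverse M z10; have R2 := qpoch_reverse M z20.
have R3 := qpoch_reverse M z30; have R4 := qpoch_reverse M w0.
have S := prod_powers_sqr M.
set t := \prod_(i < M) _ in t0 R1 R2 R3 R4 S.
have wM : (- w) ^+ M != 0 by rewrite expf_neq0 ?oppr_eq0.
have mono : (- z1) ^+ M * (- z2) ^+ M * (- z3) ^+ M * ((p / e ^+ 2) ^+ M * q ^+ (M * M))
    = (- w) ^+ M * t ^+ 2.
  rewrite S !mulrA -!exprMn; congr (_ ^+ _ * _).
  rewrite (_ : - w * q = - (w * q * e ^+ 2) / e ^+ 2); last by field.
  by rewrite -zw; ring.
apply: (mulIf t0); apply: (mulIf t0); apply: (mulIf t0).
rewrite [LHS](_ : _ = (qpoch q (z1 / q ^+ M) M * t) * (qpoch q (z2 / q ^+ M) M * t)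
   * (qpoch q (z3 / q ^+ M) M * t) * (qpoch q (q / w) M)
   * ((p / e ^+ 2) ^+ M * q ^+ (M * M))); last by ring.
rewrite R1 R2 R3 [LHS](_ : _ = qpoch q (q / z1) M * qpoch q (q / z2) M * qpoch q (q / z3) M
   * qpoch q (q / w) M * ((- z1) ^+ M * (- z2) ^+ M * (- z3) ^+ M * ((p / e ^+ 2) ^+ M
       * q ^+ (M * M))));
  last by ring.
rewrite mono [LHS](_ : _ = qpoch q (q / z1) M * qpoch q (q / z2) M * qpoch q (q / z3) M
   * (qpoch q (q / w) M * (- w) ^+ M) * t ^+ 2); last by ring.
by rewrite -R4; ring.
Qed.

(** From the product formula, as [e / q ^+ M] occurs there in three numerator factors and in
    one denominator factor.  The monomial is the one left by the pair coefficients. *)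
Lemma wp_bisum_lower (Cgc : geom_complete C) a b c d e M :
  a != 0 -> b != 0 -> c != 0 -> d != 0 -> e != 0 ->
  let p := a * b in
  dominated q a b c d (e / q ^+ M) p ->
  factors_neq0 q (c * d * e / (q * p)) ->
  qpoch q (q ^+ 2 * p / (c * d * e)) M != 0 ->
  wp_bisum q a b c d (e / q ^+ M) p * ((p / e ^+ 2) ^+ M * q ^+ (M * M)) =
  wp_bisum q a b c d e p
  * (qpoch q (q / e) M * qpoch q (q * p / (c * e)) M * qpoch q (q * p / (d * e)) M
     / qpoch q (q ^+ 2 * p / (c * d * e)) M).
Proof.
move=> a0 b0 c0 d0 e0 p domM wfac den0.
have p0 : p != 0 by rewrite mulf_neq0.
have qM0 : q ^+ M != 0 by rewrite expf_neq0.
have dom : dominated q a b c d e p.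
  apply: dominated_shrink domM; rewrite normrM normfV normrX.
  by rewrite ler_peMr // invf_ge1 ?exprn_gt0 ?normr_gt0 // exprn_ile1 // ltW.
have := wp_bisum_product Cgc q0 q1 a0 b0 domM; have := wp_bisum_product Cgc q0 q1 a0 b0 dom.
rewrite -/p; set w := c * d * e / (q * p); set H0 := wp_bisum q a b 0 0 0 0.
rewrite !(mulfK p0).
have -> : c * d * e * p / (p ^+ 2 * q) = w by rewrite /w; field; rewrite q0 p0.
have -> : c * d * (e / q ^+ M) * p / (p ^+ 2 * q) = w / q ^+ M.
  by rewrite /w; field; rewrite q0 p0 qM0.
have split_inf z : qpoch_inf q (z / q ^+ M) = qpoch q (z / q ^+ M) M * qpoch_inf q z.
  by rewrite (qpoch_inf_split Cgc q1 M) divfK.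
have -> : c * (e / q ^+ M) / p = c * e / p / q ^+ M by ring.
have -> : d * (e / q ^+ M) / p = d * e / p / q ^+ M by ring.
rewrite !split_inf => HE HM.
have w0 : w != 0 by rewrite /w !mulf_neq0 ?invr_eq0 ?mulf_neq0.
have qwE : q / w = q ^+ 2 * p / (c * d * e) by rewrite /w; field; rewrite p0 q0 c0 d0 e0.
have Ww0 : qpoch_inf q w != 0 by apply: qpoch_inf_neq0.
have wM0 : qpoch q (w / q ^+ M) M != 0.
  have : qpoch q (w / q ^+ M) M * \prod_(i < M) q ^+ i.+1 != 0.
    by rewrite qpoch_reverse // qwE mulf_neq0 // expf_neq0 // oppr_eq0.
  by rewrite mulf_eq0 negb_or => /andP[].
have ce0 : c * e / p != 0 by rewrite !mulf_neq0 ?invr_eq0.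
have de0 : d * e / p != 0 by rewrite !mulf_neq0 ?invr_eq0.
have ratio := qpoch_lower_ratio M p0 e0 e0 ce0 de0 w0.
have {ratio} := ratio _; rewrite qwE.
have -> : q / (c * e / p) = q * p / (c * e) by field; rewrite p0 c0 e0.
have -> : q / (d * e / p) = q * p / (d * e) by field; rewrite p0 d0 e0.
move=> ratio; have {}ratio := ratio _.
apply: (mulfI Ww0); apply: (mulfI wM0); apply: (mulIf den0).
rewrite [LHS](_ : _ = (qpoch q (w / q ^+ M) M * qpoch_inf q w * wp_bisum q a b c d (e / q ^+ M) p)
   * (qpoch q (q ^+ 2 * p / (c * d * e)) M * ((p / e ^+ 2) ^+ M * q ^+ (M * M)))); last by ring.
rewrite HM [RHS](_ : _ = (qpoch_inf q w * wp_bisum q a b c d e p)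
   * (qpoch q (q / e) M * qpoch q (q * p / (c * e)) M * qpoch q (q * p / (d * e)) M
      * qpoch q (w / q ^+ M) M)); last by field.
rewrite HE -ratio; first by ring.
by rewrite /w; field; rewrite q0 p0.
Qed.

End ClosedForm.

(** * Weights of the multiple sum and pair factors of rho *)

Section PairWeights.
Context {C : numFieldType}.
Variable q : C.
Hypotheses (q0 : q != 0) (q1 : `|q| < 1).
Implicit Types (e p : C) (xs ys : seq C) (ms Ns : seq nat).

(** The factors of the multiple sum are grouped here by pair: the numerators with partial sum
    [M_(s+1)] in the statement of the multiple sum belong to the pair number [s + 1]. *)
Definition pair_core p e xs ys ms s : C :=
  qpoch q (xs`_s * ys`_s / p) (nth 0%N ms s) / qpoch q q (nth 0%N ms s)
  * (qpoch q (q * p / (e * xs`_s)) (sumn (take s ms))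
       * qpoch q (q * p / (e * ys`_s)) (sumn (take s ms))
     / (qpoch q (q * xs`_s / e) (sumn (take s.+1 ms))
       * qpoch q (q * ys`_s / e) (sumn (take s.+1 ms))))
  * (xs`_s * ys`_s / p) ^+ sumn (take s ms) * q ^+ nth 0%N ms s.

Lemma pair_weightE p e xs ys Ns ms : p != 0 -> e != 0 -> ms \in boxes Ns ->
  (forall s, (s < size Ns)%N ->
     [/\ xs`_s != 0, ys`_s != 0, xs`_s * ys`_s * q ^+ nth 0%N Ns s = p,
         qpoch q (q * xs`_s / e) (sumn (take s.+1 Ns)) != 0 &
         qpoch q (q * ys`_s / e) (sumn (take s.+1 Ns)) != 0]) ->
  pair_weight q p e ys Ns ms =
  \prod_(s < size Ns)
    (qpoch q (q * ys`_s / e) (nth 0%N Ns s) * qpoch q (e * ys`_s / p) (nth 0%N Ns s))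
  * \prod_(s < size Ns) pair_core p e xs ys ms s
  * ((p / e ^+ 2) ^+ sumn ms * q ^+ (sumn ms * sumn ms)).
Proof.
move=> p0 e0 msB H.
move: (msB); rewrite mem_boxes => /andP[/eqP sz /forallP msN].
pose M s := sumn (take s ms); have MS s : M s.+1 = (M s + nth 0%N ms s)%N by exact: sumn_takeS.
have tele n :
    \prod_(s < n) ((p / e ^+ 2) ^+ nth 0%N ms s * q ^+ (M s.+1 * M s.+1) / q ^+ (M s * M s))
    = (p / e ^+ 2) ^+ M n * q ^+ (M n * M n).
  elim: n => [|n IHn]; first by rewrite big_ord0 /M take0 /= mulr1.
  rewrite big_ord_recr /= IHn MS exprD; set A := _ ^+ M n; set B := _ ^+ nth _ _ _.
  by field; rewrite expf_neq0.
have -> : sumn ms = M (size Ns) by rewrite /M take_oversize // sz.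
rewrite -tele -!big_split; apply: eq_bigr => s _ /=.
have [x0 y0 xyE dx dy] := H s (ltn_ord s).
have Mle : (M s + nth 0%N ms s <= sumn (take s.+1 Ns))%N by rewrite -MS sumn_take_le.
rewrite (pair_coef_shift q0 q1 p0 e0 x0 y0 xyE (msN s)
  (qpoch_neq0_le Mle dx) (qpoch_neq0_le Mle dy)).
by rewrite /pair_core -/(M s) -/(M s.+1) MS.
Qed.

End PairWeights.

Section RhoSummand.
Local Open Scope classical_set_scope.
Context {C : numFieldType}.
Hypothesis Cgc : geom_complete C.
Variable q : C.
Hypotheses (q0 : q != 0) (q1 : `|q| < 1).
Implicit Types (a b x y z : C) (k N : nat).
Local Notation W := (qpoch_inf q).

Lemma wp_factor_qpoch a b z k : z != 0 ->
  wp_factor q a b z k * qpoch q (- (z / b)) k.+1 =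
  z ^+ k * qpoch q (- (q * a / z)) k * W (- (z / b)) * W (- (z / a)).
Proof.
move=> z0; rewrite (qpoch_inf_split Cgc q1 k.+1 (- (z / b))) /wp_factor.
have -> : \prod_(i < k) (z + a * q ^+ i.+1) = z ^+ k * qpoch q (- (q * a / z)) k.
  rewrite -[X in z ^+ X]card_ord -prodr_const -big_split; apply: eq_bigr => i _ /=.
  by rewrite exprS; field.
by rewrite (_ : - (z / b) * q ^+ k.+1 = - (z * q ^+ k.+1 / b)); ring.
Qed.

(** The preceding formula for [z = a * b], divided by [1 + a].  As [1 + a] may be 0, this needs a
    proof of its own. *)
Lemma wp_factor_product a b k : a != 0 -> b != 0 ->
  wp_factor q a b (a * b) k * qpoch q (- (q * a)) k =
  (a * b) ^+ k * b * qpoch q (- (1 / b)) k.+1 * (W (- (q * a)) * W (- (q * b))).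
Proof.
move=> a0 b0; rewrite (qpoch_inf_split Cgc q1 k (- (q * a))) /wp_factor.
have -> : \prod_(i < k) (a * b + a * q ^+ i.+1) = (a * b) ^+ k * qpoch q (- (1 / b) * q) k.
  rewrite -[X in _ ^+ X]card_ord -prodr_const -big_split; apply: eq_bigr => i _ /=.
  by rewrite exprS; field.
rewrite qpochSl (_ : a * b / a = b); last by field.
rewrite (qpoch_inf_rec Cgc q1 (- b)) (_ : - b * q = - (q * b)); last by ring.
rewrite (_ : - (a * b * q ^+ k.+1 / b) = - (q * a) * q ^+ k); last by rewrite exprS; field.
by field.
Qed.

Lemma wp_factor_iter a b z N k : a != 0 -> b != 0 ->
  wp_factor q a b z k =
  \prod_(j < N) wp_quad q a b (z * q ^+ j) k * wp_factor q a b (z * q ^+ N) k.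
Proof.
move=> a0 b0; elim: N => [|N IHN]; first by rewrite big_ord0 mul1r expr0 mulr1.
by rewrite IHN big_ord_recr /= (wp_factor_rec Cgc q0 q1 (z * q ^+ N)) // exprSr !mulrA.
Qed.

(** As [y * q ^+ N = a * b / x], the very-well-poised factors at [y] and at [a * b / x] differ
    by [N] quadratics, and the latter factor carries the q-shifted factorials in [x], inverted. *)
Lemma pair_factorE a b x y N k : a != 0 -> b != 0 -> x != 0 -> y != 0 ->
  x * y * q ^+ N = a * b -> factors_neq0 q (- (x / b)) ->
  factors_neq0 q (- (y / a)) -> factors_neq0 q (- (y / b)) ->
  qpoch q (- (q * a / x)) k * qpoch q (- (q * a / y)) k
    / (qpoch q (- (x / b)) k.+1 * qpoch q (- (y / b)) k.+1) =
  b * (W (- (q * a / x)) * W (- (q * b / x)) / (x * (W (- (y / a)) * W (- (y / b)))))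
  * (q ^+ N) ^+ k * \prod_(j < N) wp_quad q a b (y * q ^+ j) k.
Proof.
move=> a0 b0 x0 y0 xyE xbP yaP ybP.
have zE : y * q ^+ N = a * b / x by rewrite -xyE; field.
have Hy := wp_factor_qpoch a b k y0.
have z0 : a * b / x != 0 by rewrite !mulf_neq0 ?invr_eq0.
have Hz := wp_factor_qpoch a b k z0.
rewrite (wp_factor_iter y N k a0 b0) zE in Hy.
have axP : factors_neq0 q (- (a / x)).
  move=> i; rewrite (_ : - (a / x) * q ^+ i = - (y / b) * q ^+ (N + i)) //.
  by rewrite exprD -[a](mulfK b0) -xyE; field; rewrite x0 b0.
have ax1 : 1 + a / x != 0 by have := axP 0%N; rewrite expr0 mulr1 opprK.
have xb1 : 1 + x / b != 0 by have := xbP 0%N; rewrite expr0 mulr1 opprK.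
have := qpoch_neq0 k.+1 xbP; have := qpoch_neq0 k.+1 ybP; have := qpoch_neq0 k.+1 axP.
have Wya := qpoch_inf_neq0 Cgc q1 yaP; have Wyb := qpoch_inf_neq0 Cgc q1 ybP.
move: Hz; rewrite (_ : a * b / x / b = a / x); last by field; rewrite x0 b0.
rewrite (_ : a * b / x / a = b / x); last by field; rewrite x0 a0.
rewrite (_ : q * a / (a * b / x) = x / b * q); last by field; rewrite a0 b0 x0.
rewrite (qpoch_inf_rec Cgc q1 (- (a / x))) (qpoch_inf_rec Cgc q1 (- (b / x))).
rewrite !(qpochSl q (- (a / x))) !(qpochSl q (- (x / b))) !opprK !mulNr.
rewrite (_ : a / x * q = q * a / x); last by ring.
rewrite (_ : b / x * q = q * b / x); last by ring.
rewrite !mulf_eq0 !negb_or => Hz /andP[_ A0] B0 /andP[_ C0].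
have zyk : (a * b / x) ^+ k = y ^+ k * (q ^+ N) ^+ k by rewrite -exprMn zE.
rewrite {}zyk in Hz.
have yk0 : y ^+ k != 0 by rewrite expf_neq0.
move: Hz Hy A0 B0 C0 Wya Wyb.
move: (qpoch q (- (q * a / x)) k) (qpoch q (- (q * a / y)) k) (qpoch q (- (y / b)) k.+1)
  (qpoch q (- (x / b * q)) k) => A Y B D.
move: (\prod_(j < N) _) (wp_factor q a b _ k) => P G.
move: (W (- (q * a / x))) (W (- (q * b / x))) (W (- (y / a))) (W (- (y / b))) => Wa Wb Wc Wd.
move: yk0; move: (y ^+ k) ((q ^+ N) ^+ k) => yk Qk yk0 Hz Hy A0 B0 D0 Wc0 Wd0.
have GE : G = yk * Qk * D * Wa * ((1 + b / x) * Wb) / A.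
  apply: (mulIf (mulf_neq0 ax1 A0)); rewrite Hz.
  by field; rewrite A0 x0.
have YE : Y = P * G * B / (yk * Wd * Wc).
  have F : yk * Wd * Wc != 0 by rewrite !mulf_neq0.
  by apply: (mulIf F); rewrite divfK // Hy; ring.
have xb2 : b + x != 0.
  by rewrite (_ : b + x = b * (1 + x / b)) ?mulf_neq0 //; field.
by rewrite YE GE; field; rewrite A0 B0 D0 Wc0 Wd0 x0 b0 yk0 xb2.
Qed.

End RhoSummand.

(** * The series rho as a very-well-poised series *)

Section RhoReduction.
Local Open Scope classical_set_scope.
Context {C : numFieldType}.
Hypothesis Cgc : geom_complete C.
Variable q : C.
Hypotheses (q0 : q != 0) (q1 : `|q| < 1).
Local Notation W := (qpoch_inf q).

Definition pair_const (a b x y : C) : C :=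
  W (- (q * a / x)) * W (- (q * b / x)) / (x * (W (- (y / a)) * W (- (y / b)))).

Definition rho_den (a b c d e : C) : C :=
  W (- (q * a)) * W (- (q * b)) * (W (- (c / a)) * W (- (c / b)))
  * (W (- (d / a)) * W (- (d / b))) * (W (- (e / a)) * W (- (e / b))).

Lemma prod_expr_nth (Ns : seq nat) n : \prod_(i < n) q ^+ nth 0%N Ns i = q ^+ sumn (take n Ns).
Proof.
elim: n => [|n IHn]; first by rewrite big_ord0 take0.
by rewrite big_ord_recr /= IHn sumn_takeS exprD.
Qed.

(** The constant in front is symmetric in [a] and [b], so that the difference of two values of
    rho becomes one bisum. *)
Lemma rhoE n (Ns : n.-tuple nat) (a b c d e : C) (x y : n.-tuple C) (l : C) :
  a != 0 -> b != 0 -> c != 0 -> d != 0 -> e != 0 ->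
  (forall z : C, z \in [:: - (q * a); - (q * b); - (c / a); - (c / b); - (d / a);
                 - (d / b); - (e / a); - (e / b)] -> factors_neq0 q z) ->
  (forall (i : 'I_n), [/\ x`_i != 0, y`_i != 0 &
     x`_i * y`_i * q ^+ nth 0%N Ns i = a * b]) ->
  (forall (i : 'I_n) (z : C), z \in [:: - (x`_i / a); - (x`_i / b); - (y`_i / a); - (y`_i / b)] ->
     factors_neq0 q z) ->
  series (fun k => wp_term q a b c d e (a * b) k * pair_prod q a b y Ns k) @ \oo --> l ->
  rho q a b c d e x y (sumn Ns) =
  (\prod_(i < n) pair_const a b x`_i y`_i / rho_den a b c d e) * l.
Proof.
move=> a0 b0 c0 d0 e0 denP xyE xyP lP.
have Wneq0 (z : C) : z \in [:: - (q * a); - (q * b); - (c / a); - (c / b); - (d / a);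
    - (d / b); - (e / a); - (e / b)] -> W z != 0.
  by move=> /denP zP; apply: qpoch_inf_neq0.
have D0 : rho_den a b c d e != 0 by rewrite !mulf_neq0 // Wneq0 // !inE eqxx ?orbT.
have qn0 m : q ^+ m != 0 by rewrite expf_neq0.
have tupleE (t : n.-tuple C) (g : C -> C) : \prod_(z <- t) g z = \prod_(i < n) g t`_i.
  by rewrite big_tuple; apply: eq_bigr => i _; rewrite (tnth_nth 0).
have pairsE k :
    qpochs q [seq - (q * a / z) | z <- x ++ y] k / qpochs q [seq - (z / b) | z <- x ++ y] k.+1
    = b ^+ n * \prod_(i < n) pair_const a b x`_i y`_i
      * (q ^+ sumn Ns) ^+ k * pair_prod q a b y Ns k.
  rewrite /qpochs !big_map !big_cat /= !tupleE -!big_split -prodf_div /=.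
  have -> : b ^+ n = \prod_(i < n) b by rewrite prodr_const card_ord.
  have -> : (q ^+ sumn Ns) ^+ k = \prod_(i < n) (q ^+ nth 0%N Ns i) ^+ k.
    by rewrite prodrXl prod_expr_nth take_oversize // size_tuple.
  rewrite /pair_prod size_tuple -!big_split; apply: eq_bigr => i _ /=.
  have [x0 y0 E] := xyE i.
  by rewrite (pair_factorE Cgc q0 q1 k a0 b0 x0 y0 E) //; apply: (xyP i);
    rewrite !inE eqxx ?orbT.
have termE k : (1 - a * q ^+ (2 * k + 1) / b)
    * (qpoch q (- (1 / b)) k.+1 / qpoch q (- (q * a)) k)
    * (qpochs q [seq - (q * a / z) | z <- [:: c, d, e & x ++ y]] k
       / qpochs q [seq - (z / b) | z <- [:: c, d, e & x ++ y]] k.+1)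
    * (c * d * e / (a * b * q ^+ (sumn Ns).+1)) ^+ k
  = b ^+ n * (\prod_(i < n) pair_const a b x`_i y`_i / rho_den a b c d e)
    * (wp_term q a b c d e (a * b) k * pair_prod q a b y Ns k).
  have consE (g : C -> C) m : qpochs q [seq g z | z <- [:: c, d, e & x ++ y]] m =
      qpoch q (g c) m * qpoch q (g d) m * qpoch q (g e) m * qpochs q [seq g z | z <- x ++ y] m.
    by rewrite /qpochs /= !big_cons !mulrA.
  rewrite !consE.
  have Fc := wp_factor_qpoch Cgc q1 a b k c0; have Fd := wp_factor_qpoch Cgc q1 a b k d0.
  have Fe := wp_factor_qpoch Cgc q1 a b k e0; have Fp := wp_factor_product Cgc q1 k a0 b0.
  have B1 : qpoch q (- (q * a)) k != 0 by apply: qpoch_neq0; apply: denP; rewrite !inE eqxx.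
  have Bc : qpoch q (- (c / b)) k.+1 != 0.
    by apply: qpoch_neq0; apply: denP; rewrite !inE eqxx ?orbT.
  have Bd : qpoch q (- (d / b)) k.+1 != 0.
    by apply: qpoch_neq0; apply: denP; rewrite !inE eqxx ?orbT.
  have Be : qpoch q (- (e / b)) k.+1 != 0.
    by apply: qpoch_neq0; apply: denP; rewrite !inE eqxx ?orbT.
  rewrite -[X in _ * X * _ = _]mulf_div pairsE /wp_term.
  move: D0; rewrite /rho_den => D0.
  move: Fc => /(canRL (mulfK Bc)) ->; move: Fd => /(canRL (mulfK Bd)) ->.
  move: Fe => /(canRL (mulfK Be)) ->; move: Fp => /(canRL (mulfK B1)) ->.
  have E1 : (c * d * e / (a * b * q ^+ (sumn Ns).+1)) ^+ k =
      c ^+ k * d ^+ k * e ^+ k * (a * b) ^+ k / ((a * b) ^+ 2 * q) ^+ k / (q ^+ sumn Ns) ^+ k.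
    rewrite -!exprMn -!expr_div_n; congr (_ ^+ k).
    by rewrite exprS; field; rewrite a0 b0 q0 qn0.
  rewrite E1.
  move: (pair_prod _ _ _ _ _ _) (\prod_(i < n) _) => P1 P2.
  have u0 : (q ^+ sumn Ns) ^+ k != 0 by rewrite !expf_neq0.
  have v0 : ((a * b) ^+ 2 * q) ^+ k != 0 by rewrite expf_neq0 // mulf_neq0 // expf_neq0 //
      mulf_neq0.
  move: D0 u0 v0 B1 Bc Bd Be; rewrite !mulf_eq0 !negb_or => /andP[/andP[/andP[/andP[W1 W2]]]].
  move=> /andP[W3 W4] /andP[W5 W6] /andP[W7 W8].
  move: (W _) (W _) (W _) (W _) (W _) (W _) (W _) (W _) W1 W2 W3 W4 W5 W6 W7 W8.
  move=> w1 w2 w3 w4 w5 w6 w7 w8 W1 W2 W3 W4 W5 W6 W7 W8 u0 v0 B1 Bc Bd Be.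
  move: (_ ^+ k) (_ ^+ k) u0 v0 => u v u0 v0.
  by field; rewrite ?W1 ?W2 ?W3 ?W4 ?W5 ?W6 ?W7 ?W8 ?u0 ?v0 ?B1 ?Bc ?Bd ?Be ?a0 ?b0.
have sumE := cvg_seriesZ
  (x := b ^+ n * (\prod_(i < n) pair_const a b x`_i y`_i / rho_den a b c d e)) lP.
rewrite /rho (funext termE) (cvg_lim _ sumE); last exact: norm_hausdorff.
by rewrite !mulrA mulVf ?mul1r // expf_neq0.
Qed.

End RhoReduction.

(** * The terms of the multiple sum *)

Section MultisumTerm.
Context {C : numFieldType}.
Variable q : C.
Implicit Types (a b c d e : C).

Definition multi_tail (p c d e : C) M : C :=
  qpoch q (q / e) M * qpoch q (q * p / (c * e)) M * qpoch q (q * p / (d * e)) M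
  / qpoch q (q ^+ 2 * p / (c * d * e)) M.

(** For the first pair the partial sum [M] is 0, which makes its numerators and its power
    equal to 1: this accounts for the product over [s < n] instead of [s < n.+1]. *)
Lemma multisum_termE n a b c d e (x y : n.+1.-tuple C) (m : n.+1.-tuple nat) :
  multisum_term q a b c d e x y m =
  \prod_(s < n.+1) pair_core q (a * b) e x y m s * multi_tail (a * b) c d e (sumn m).
Proof.
pose A s := qpoch q (x`_s * y`_s / (a * b)) (nth 0%N m s) / qpoch q q (nth 0%N m s).
pose B s := (qpoch q (q * x`_s / e) (sumn (take s.+1 m))
       * qpoch q (q * y`_s / e) (sumn (take s.+1 m)))^-1.
pose D s := qpoch q (q * (a * b) / (e * x`_s)) (sumn (take s m))
       * qpoch q (q * (a * b) / (e * y`_s)) (sumn (take s m))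
       * (x`_s * y`_s / (a * b)) ^+ sumn (take s m).
have coreE s : pair_core q (a * b) e x y m s = A s * B s * D s * q ^+ nth 0%N m s.
  by rewrite /pair_core /A /B /D; ring.
have -> : \prod_(s < n.+1) pair_core q (a * b) e x y m s = \prod_(s < n.+1) A s
    * \prod_(s < n.+1) B s * \prod_(s < n.+1) D s * \prod_(s < n.+1) q ^+ nth 0%N m s.
  by rewrite -!big_split; apply: eq_bigr => s _; rewrite coreE.
have -> : \prod_(s < n.+1) q ^+ nth 0%N m s = q ^+ sumn m.
  by rewrite prod_expr_nth take_oversize // size_tuple.
have -> : \prod_(s < n.+1) A s = \prod_(s < n) A s * A n by rewrite big_ord_recr.
have -> : \prod_(s < n.+1) B s = \prod_(s < n) B s * B n by rewrite big_ord_recr.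
have -> : \prod_(s < n.+1) D s = \prod_(s < n) D s.+1.
  rewrite big_ord_recl {1}/D take0 !qpoch0 expr0 !mulr1 mul1r.
  by apply: eq_bigr.
have takeS : take n.+1 m = m by rewrite take_oversize // size_tuple.
rewrite /multisum_term /= takeS /multi_tail.
set P := \prod_(s < n) _.
have -> : P = \prod_(s < n) A s * \prod_(s < n) B s * \prod_(s < n) D s.+1.
  rewrite -!big_split; apply: eq_bigr => s _.
  by rewrite /qpochs !big_cons !big_nil /A /B /D !mulr1 !mulrA /=; ring.
rewrite /qpochs !big_cons !big_nil !mulr1 -/(A n) -!(mulrA q a) -!(mulrA (q ^+ 2) a).
by rewrite /B takeS !invfM; ring.
Qed.

End MultisumTerm.

(** * The identity *)

Section MainIdentity.
Local Open Scope classical_set_scope.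
Context {C : numFieldType}.
Hypothesis Cgc : geom_complete C.
Variable q : C.
Hypotheses (q0 : q != 0) (q1 : `|q| < 1).
Implicit Types (a b c d e : C).
Local Notation W := (qpoch_inf q).

Lemma qpoch_vanish z i m : z * q ^+ i = 1 -> (i < m)%N -> qpoch q z m = 0.
Proof. by move=> zi im; rewrite /qpoch (bigD1 (Ordinal im)) //= zi subrr mul0r. Qed.

(** Outside the box some [x_s * y_s / (a * b) = q ^- N_s] makes a factorial of length
    [m_s > N_s] vanish. *)
Lemma multisumE n (Ns : n.-tuple nat) a b c d e (x y : n.-tuple C) :
  (forall i : 'I_n, x`_i * y`_i / (a * b) * q ^+ nth 0%N Ns i = 1) ->
  multisum q a b c d e x y =
  \sum_(ms <- boxes Ns) \prod_(s < n) pair_core q (a * b) e x y ms s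
    * multi_tail q (a * b) c d e (sumn ms).
Proof.
case: n Ns x y => [|n] Ns x y xyN.
  have -> : boxes Ns = [:: [::]] by rewrite (tuple0 Ns).
  by rewrite /multisum /= big_seq1 big_ord0 /multi_tail /= !qpoch0 !mulr1 mul1r divr1.
rewrite /multisum /=; apply: fsbig_boxes => m; last by rewrite multisum_termE.
have szm : size m == size Ns by rewrite !size_tuple.
rewrite multisum_termE mem_boxes szm /= negb_forall => /existsP[s].
have sn : (s < n.+1)%N by rewrite -[X in (_ < X)%N](size_tuple Ns).
rewrite -ltnNge => lts; rewrite (bigD1 (Ordinal sn)) //= /pair_core.
by rewrite (qpoch_vanish (xyN (Ordinal sn)) lts) !mul0r.
Qed.

(** The finite products are [pair_coef q (a * b) y e N 0].  They complete the infinite products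
    in the denominator to those in the numerator, since [y * q ^+ N = a * b / x]. *)
Lemma pair_const_inf a b e x y N : a != 0 -> b != 0 -> e != 0 -> x != 0 -> y != 0 ->
  x * y * q ^+ N = a * b ->
  W (e / x) != 0 -> W (q * (a * b) / (e * x)) != 0 ->
  pair_const q a b x y * (qpoch q (q * y / e) N * qpoch q (e * y / (a * b)) N) =
  1 / x * (qpochs_inf q [:: - (q * a / x); - (q * b / x); q * y / e; e * y / (a * b)]
          / qpochs_inf q [:: e / x; q * (a * b) / (e * x); - (y / a); - (y / b)]).
Proof.
move=> a0 b0 e0 x0 y0 xyE We Wq; rewrite /qpochs_inf !big_cons !big_nil !mulr1.
rewrite (qpoch_inf_split Cgc q1 N (q * y / e)) (qpoch_inf_split Cgc q1 N (e * y / (a * b))).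
have -> : q * y / e * q ^+ N = q * (a * b) / (e * x) by rewrite -xyE; field; rewrite e0 x0.
have -> : e * y / (a * b) * q ^+ N = e / x.
  by rewrite -xyE; field; rewrite x0 y0 expf_neq0.
move: (W (e / x)) (W (q * (a * b) / _)) We Wq => w1 w2 w10 w20.
rewrite /pair_const !invfM; move: (W (- (y / a)))^-1 (W (- (y / b)))^-1 => v1 v2.
by field; rewrite w10 w20 x0.
Qed.

(** Both series rho are brought to the constant of [rhoE]; the pairs are expanded, the lowered
    two-sided sums are reduced to a single one, and the latter has a product formula. *)
Theorem bilateral_identity n (Ns : n.-tuple nat) a b c d e (x y : n.-tuple C) :
  a != 0 -> b != 0 -> c != 0 -> d != 0 -> e != 0 ->
  (forall i : 'I_n, x`_i != 0) -> (forall i : 'I_n, y`_i != 0) ->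
  (forall z : C,
       z \in [:: - (q * a); - (q * b); - (c / a); - (c / b); - (d / a);
                 - (d / b); - (e / a); - (e / b); c * d * e / (q * a * b)] ->
       factors_neq0 q z) ->
  (forall (i : 'I_n) (z : C),
       z \in [:: - (x`_i / a); - (x`_i / b); - (y`_i / a); - (y`_i / b);
                 e / x`_i; q * a * b / (e * x`_i)] ->
       factors_neq0 q z) ->
  (forall (s : 'I_n) (z : C),
       z \in [:: q * x`_s / e; q * y`_s / e] ->
       qpoch q z (sumn (take s.+1 Ns)) != 0) ->
  qpoch q (q ^+ 2 * a * b / (c * d * e)) (sumn Ns) != 0 ->
  (forall i : 'I_n, a * b / (x`_i * y`_i) = q ^+ nth 0%N Ns i) ->
  `|c * d * e / (a * b * q ^+ (sumn Ns).+1)| < 1 ->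
  rho q a b c d e x y (sumn Ns) - rho q b a c d e x y (sumn Ns) =
  (1 / b - 1 / a)
  * (qpochs_inf q [:: q; q * a / b; q * b / a; c; d; e;
                      c * d / (a * b); c * e / (a * b); d * e / (a * b)]
     / qpochs_inf q [:: - (q * a); - (q * b); - (c / a); - (c / b); - (d / a);
                        - (d / b); - (e / a); - (e / b);
                        c * d * e / (q * a * b)])
  * \prod_(i < n)
      (1 / x`_i
       * (qpochs_inf q [:: - (q * a / x`_i); - (q * b / x`_i);
                           q * y`_i / e; e * y`_i / (a * b)]
          / qpochs_inf q [:: e / x`_i; q * a * b / (e * x`_i);
                             - (y`_i / a); - (y`_i / b)]))
  * multisum q a b c d e x y.
Proof.
move=> a0 b0 c0 d0 e0 x0 y0 denP xyP sumP lastP xyN lt1.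
set p := a * b; have p0 : p != 0 by rewrite mulf_neq0.
have qn0 m : q ^+ m != 0 by rewrite expf_neq0.
have xyE (i : 'I_n) : x`_i * y`_i * q ^+ nth 0%N Ns i = p.
  by rewrite -xyN -/p; field; rewrite x0 y0.
have norm_lt (r : C) : r != 0 -> `|c * d * e / (r * q ^+ (sumn Ns).+1)| < 1 ->
    `|c| * `|d| * `|e / q ^+ sumn Ns| * `|r| < `|r| ^+ 2 * `|q|.
  move=> r0; rewrite exprS !normrM !normfV ltr_pdivrMr ?normr_gt0 ?mulf_neq0 //.
  rewrite mul1r !normrM => lt2.
  have pos : 0 < `|r| / `|q ^+ sumn Ns| by rewrite divr_gt0 ?normr_gt0.
  have nq : `|q ^+ sumn Ns| != 0 by rewrite normr_eq0.
  move: lt2; rewrite -(ltr_pM2r pos).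
  rewrite [X in X < _ -> _](_ : _ = `|c| * `|d| * (`|e| / `|q ^+ sumn Ns|) * `|r|); last by ring.
  by rewrite [X in _ < X -> _](_ : _ = `|r| ^+ 2 * `|q|) //; field.
have dom : dominated q a b c d (e / q ^+ sumn Ns) p.
  exists `|c|, `|d|, `|e / q ^+ sumn Ns|, `|p|; split; last exact: norm_lt lt1.
    by split; rewrite normr_gt0 ?mulf_neq0 ?invr_eq0.
  by split.
have sz : size y = size Ns by rewrite !size_tuple.
have [l1P l2P lE] := is_bisum_pairs Cgc q0 q1 a0 b0 e0 sz dom.
have subP (z : C) : z \in [:: - (q * a); - (q * b); - (c / a); - (c / b); - (d / a);
    - (d / b); - (e / a); - (e / b)] -> factors_neq0 q z.
  by move=> zin; apply: denP; move: zin; rewrite !inE !orbA => ->.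
have subP' (z : C) : z \in [:: - (q * b); - (q * a); - (c / b); - (c / a); - (d / b);
    - (d / a); - (e / b); - (e / a)] -> factors_neq0 q z.
  move=> zin; apply: denP; move: zin; rewrite !inE.
  by move=> /or4P[||| /or4P[||| /orP[]]] /eqP ->; rewrite eqxx ?orbT.
have xyP1 (i : 'I_n) (z : C) :
    z \in [:: - (x`_i / a); - (x`_i / b); - (y`_i / a); - (y`_i / b)] -> factors_neq0 q z.
  by move=> zin; apply: (xyP i); move: zin; rewrite !inE => /or4P[] /eqP ->; rewrite eqxx ?orbT.
have xyP2 (i : 'I_n) (z : C) :
    z \in [:: - (x`_i / b); - (x`_i / a); - (y`_i / b); - (y`_i / a)] -> factors_neq0 q z.
  by move=> zin; apply: (xyP i); move: zin; rewrite !inE => /or4P[] /eqP ->; rewrite eqxx ?orbT.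
have rho1 := rhoE Cgc q0 q1 a0 b0 c0 d0 e0 subP (fun i => And3 (x0 i) (y0 i) (xyE i)) xyP1 l1P.
have pba : b * a = p by rewrite mulrC.
have xyE' (i : 'I_n) : x`_i * y`_i * q ^+ nth 0%N Ns i = b * a by rewrite pba.
rewrite -pba in l2P.
have rho2 := rhoE Cgc q0 q1 b0 a0 c0 d0 e0 subP' (fun i => And3 (x0 i) (y0 i) (xyE' i)) xyP2 l2P.
have constE : \prod_(i < n) pair_const q b a x`_i y`_i / rho_den q b a c d e =
    \prod_(i < n) pair_const q a b x`_i y`_i / rho_den q a b c d e.
  congr (_ / _); last by rewrite /rho_den; ring.
  by apply: eq_bigr => i _; rewrite /pair_const; congr (_ / (_ * _)); ring.
rewrite rho1 rho2 pba constE -mulrBr -lE -/p.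
have factE (i : 'I_n) : pair_const q a b x`_i y`_i
    * (qpoch q (q * y`_i / e) (nth 0%N Ns i) * qpoch q (e * y`_i / p) (nth 0%N Ns i)) =
  1 / x`_i * (qpochs_inf q [:: - (q * a / x`_i); - (q * b / x`_i); q * y`_i / e; e * y`_i / p]
          / qpochs_inf q [:: e / x`_i; q * a * b / (e * x`_i); - (y`_i / a); - (y`_i / b)]).
  rewrite -!(mulrA q a b); apply: pair_const_inf => //; rewrite ?mulrA;
    by apply: qpoch_inf_neq0 => //; apply: (xyP i); rewrite !inE eqxx ?orbT.
have -> : \prod_(i < n) (1 / x`_i
      * (qpochs_inf q [:: - (q * a / x`_i); - (q * b / x`_i); q * y`_i / e; e * y`_i / p]
          / qpochs_inf q [:: e / x`_i; q * a * b / (e * x`_i); - (y`_i / a); - (y`_i / b)]))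
    = \prod_(i < n) pair_const q a b x`_i y`_i
      * \prod_(i < n) (qpoch q (q * y`_i / e) (nth 0%N Ns i)
                        * qpoch q (e * y`_i / p) (nth 0%N Ns i)).
  by rewrite -big_split; apply: eq_bigr => i _; rewrite -factE.
have weightE ms : ms \in boxes Ns ->
    pair_weight q p e y Ns ms * wp_bisum q a b c d (e / q ^+ sumn ms) p =
    \prod_(i < n) (qpoch q (q * y`_i / e) (nth 0%N Ns i) * qpoch q (e * y`_i / p) (nth 0%N Ns i))
    * wp_bisum q a b c d e p
    * (\prod_(s < n) pair_core q p e x y ms s * multi_tail q p c d e (sumn ms)).
  move=> msB; have szN : size Ns = n by rewrite size_tuple.
  have Mle : (sumn ms <= sumn Ns)%N.
    have := sumn_take_le (size Ns) msB; move: (msB); rewrite mem_boxes => /andP[/eqP szm _].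
    by rewrite !take_oversize // szm.
  have domM : dominated q a b c d (e / q ^+ sumn ms) p.
    apply: dominated_shrink dom; rewrite !normrM !normfV !normrX ler_wpM2l //.
    rewrite lef_pV2 ?posrE ?exprn_gt0 ?normr_gt0 //.
    by apply: ler_wiXn2l => //; exact: ltW.
  have wfac : factors_neq0 q (c * d * e / (q * p)).
    by apply: denP; rewrite /p mulrA !inE eqxx ?orbT.
  have lastM : qpoch q (q ^+ 2 * p / (c * d * e)) (sumn ms) != 0.
    by apply: qpoch_neq0_le Mle _; rewrite /p mulrA.
  have := wp_bisum_lower q0 q1 Cgc a0 b0 c0 d0 e0 domM wfac lastM; rewrite -/p => low.
  rewrite (pair_weightE q0 q1 (xs := x) p0 e0 msB); last first.
    move=> s; rewrite szN => sn; pose i := Ordinal sn.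
    by split; [exact: (x0 i)|exact: (y0 i)|exact: (xyE i)|apply: (sumP i)|apply: (sumP i)];
       rewrite !inE eqxx ?orbT.
  rewrite szN [LHS](_ : _ = \prod_(s < n) (qpoch q (q * y`_s / e) (nth 0%N Ns s)
      * qpoch q (e * y`_s / p) (nth 0%N Ns s))
    * \prod_(s < n) pair_core q p e x y ms s
    * (wp_bisum q a b c d (e / q ^+ sumn ms) p
        * ((p / e ^+ 2) ^+ sumn ms * q ^+ (sumn ms * sumn ms)))); last by ring.
  by rewrite low -/(multi_tail q p c d e (sumn ms)); ring.
have -> : \sum_(ms <- boxes Ns) pair_weight q p e y Ns ms
      * wp_bisum q a b c d (e / q ^+ sumn ms) p =
    \prod_(i < n) (qpoch q (q * y`_i / e) (nth 0%N Ns i) * qpoch q (e * y`_i / p) (nth 0%N Ns i))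
    * wp_bisum q a b c d e p
    * \sum_(ms <- boxes Ns) \prod_(s < n) pair_core q p e x y ms s
        * multi_tail q p c d e (sumn ms).
  by rewrite mulr_sumr big_seq [RHS]big_seq; apply: eq_bigr.
rewrite (@multisumE n Ns a b c d e x y); last first.
  by move=> i; rewrite -/p mulrAC xyE mulfV.
move: (\sum_(ms <- boxes Ns) _) => S.
have dome : dominated q a b c d e p.
  apply: dominated_shrink dom; rewrite normrM normfV normrX.
  by rewrite ler_peMr // invf_ge1 ?exprn_gt0 ?normr_gt0 // exprn_ile1 // ltW.
have := wp_bisum_product Cgc q0 q1 a0 b0 dome.
rewrite (wp_bisum_theta Cgc q0 q1 a0 b0) -/p !(mulfK p0).
have -> : c * d * e * p / (p ^+ 2 * q) = c * d * e / (q * a * b).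
  by rewrite /p; field; rewrite a0 b0 q0.
have Ww0 : W (c * d * e / (q * a * b)) != 0.
  by apply: qpoch_inf_neq0 => //; apply: denP; rewrite !inE eqxx ?orbT.
move=> /(canRL (mulKf Ww0)) ->.
rewrite /qpochs_inf !big_cons !big_nil !mulr1 /rho_den !invfM.
move: (\prod_(i < n) _) (\prod_(i < n) _) => P1 P2.
by ring.
Qed.

End MainIdentity.

Unset Implicit Arguments.

Theorem theorem7 (R : realType) (n : nat) (Ns : n.-tuple nat)
    (q a b c d e : R[i]) (x y : n.-tuple R[i])
    (q_gt0 : 0 < `|q|) (q_lt1 : `|q| < 1)
    (a_neq0 : a != 0) (b_neq0 : b != 0) (c_neq0 : c != 0) (d_neq0 : d != 0)
    (e_neq0 : e != 0)
    (x_neq0 : forall i : 'I_n, x`_i != 0)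
    (y_neq0 : forall i : 'I_n, y`_i != 0)
    (* no zero factors in the denominators of rho and of the infinite
       products *)
    (den_neq0 : forall z : R[i],
       z \in [:: - (q * a); - (q * b); - (c / a); - (c / b); - (d / a);
                 - (d / b); - (e / a); - (e / b); c * d * e / (q * a * b)] ->
       factors_neq0 q z)
    (den_xy_neq0 : forall (i : 'I_n) (z : R[i]),
       z \in [:: - (x`_i / a); - (x`_i / b); - (y`_i / a); - (y`_i / b);
                 e / x`_i; q * a * b / (e * x`_i)] ->
       factors_neq0 q z)
    (* no zero factors in the denominators of the terms of the finite multiple
       sum, in which M_s runs from 0 to N_1 + ... + N_s *)
    (den_sum_neq0 : forall (s : 'I_n) (z : R[i]),
       z \in [:: q * x`_s / e; q * y`_s / e] ->
       qpoch q z (sumn (take s.+1 Ns)) != 0)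
    (den_sum_last_neq0 :
       qpoch q (q ^+ 2 * a * b / (c * d * e)) (sumn Ns) != 0)
    (xyE : forall i : 'I_n, a * b / (x`_i * y`_i) = q ^+ nth 0%N Ns i)
    (cde_lt1 : `|c * d * e / (a * b * q ^+ (sumn Ns).+1)| < 1) :
  rho q a b c d e x y (sumn Ns) - rho q b a c d e x y (sumn Ns) =
  (1 / b - 1 / a)
  * (qpochs_inf q [:: q; q * a / b; q * b / a; c; d; e;
                      c * d / (a * b); c * e / (a * b); d * e / (a * b)]
     / qpochs_inf q [:: - (q * a); - (q * b); - (c / a); - (c / b); - (d / a);
                        - (d / b); - (e / a); - (e / b);
                        c * d * e / (q * a * b)])
  * \prod_(i < n)
      (1 / x`_i
       * (qpochs_inf q [:: - (q * a / x`_i); - (q * b / x`_i);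
                           q * y`_i / e; e * y`_i / (a * b)]
          / qpochs_inf q [:: e / x`_i; q * a * b / (e * x`_i);
                             - (y`_i / a); - (y`_i / b)]))
  * multisum q a b c d e x y.

Proof.
have q0 : q != 0 by rewrite -normr_gt0.
exact: (@bilateral_identity (R[i] : numFieldType) (@complex_geom_complete R) q q0 q_lt1 n Ns
  a b c d e x y a_neq0 b_neq0 c_neq0 d_neq0 e_neq0 x_neq0 y_neq0 den_neq0 den_xy_neq0
  den_sum_neq0 den_sum_last_neq0 xyE cde_lt1).
Qed.
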